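(* For any $0<r<1$, the Konno distribution $\mathrm K_r$ is Boolean self-decomposable.
   Context: For $r\in(0,1)$, the (symmetric) Konno distribution is the probability measure $$\mathrm K_r(dx)=\frac{\sqrt{1-r^2}}{\pi(1-x^2)\sqrt{r^2-x^2}}\mathbf 1_{(-r,r)}(x)\,dx,$$ whose Cauchy transform is $\frac{z(z^2-r^2)-\sqrt{1-r^2}\sqrt{z^2-r^2}}{(z^2-1)(z^2-r^2)}$. For a probability measure $\mu$ on $\mathbb R$ let $G_\mu(z)=\int_{\mathbb R}\frac{\mu(dx)}{z-x}$ and $F_\mu(z)=1/G_\mu(z)$ for $z\in\mathbb C^+$ (the upper half-plane). The Boolean convolution $\mu\uplus\nu$ of probability measures $\mu,\nu$ on $\mathbb R$ is the probability measure characterized by $F_{\mu\uplus\nu}(z)=F_\mu(z)+F_\nu(z)-z$, $z\in\mathbb C^+$. $D_c(\mu)$ is the push-forward of $\mu$ under $x\mapsto cx$. A probability measure $\mu$ on $\mathbb R$ is Boolean self-decomposable if for every $c\in(0,1)$ there is a probability measure $\mu_c$ on $\mathbb R$ with $\mu=D_c(\mu)\uplus\mu_c$. *)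

(* Defs.v *)
From HB Require Import structures.
From mathcomp Require Import all_boot all_order all_algebra.
From mathcomp Require Import all_classical all_reals all_analysis.
From mathcomp Require Import measurable_realfun.
From mathcomp Require Import complex ring lra.

Set Implicit Arguments.
Unset Strict Implicit.
Unset Printing Implicit Defensive.

Import Order.TTheory GRing.Theory Num.Theory.
Import numFieldNormedType.Exports.

Local Open Scope classical_set_scope.
Local Open Scope ring_scope.

Section konno_pdf.
Context {R : realType}.
Variable r : R.
Local Notation mu := (@lebesgue_measure R).

Let konno_pdfT (x : R) : R :=
  Num.sqrt (1 - r ^+ 2) / (pi * (1 - x ^+ 2) * Num.sqrt (r ^+ 2 - x ^+ 2)).

Definition konno_pdf : R -> R := konno_pdfT \_ `]-r, r[.

Hypothesis r01 : 0 < r < 1.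

Let r0 : 0 < r. Proof. by case/andP: r01. Qed.
Let r1 : r < 1. Proof. by case/andP: r01. Qed.

Let itv_sqr (x : R) : x \in `]-r, r[ -> x ^+ 2 < r ^+ 2.
Proof. by rewrite in_itv/= => /andP[? ?]; nra. Qed.

Let r2_lt1 : r ^+ 2 < 1.
Proof. by have := r0; have := r1; nra. Qed.

Lemma konno_pdf_ge0 x : 0 <= konno_pdf x.
Proof.
apply: restrict_ge0 => {}x /itv_sqr xr.
rewrite divr_ge0 ?sqrtr_ge0// !mulr_ge0 ?pi_ge0 ?sqrtr_ge0//.
by have := r2_lt1; lra.
Qed.

Let konno_pdfT_continuous (x : R) : x \in `]-r, r[ ->
  {for x, continuous konno_pdfT}.
Proof.
move=> /itv_sqr xr; have r2 := r2_lt1.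
apply: cvgM; first exact: cvg_cst.
apply: cvgV.
  by rewrite !mulf_neq0 ?gt_eqF ?pi_gt0 ?sqrtr_gt0 ?subr_gt0//; lra.
apply: cvgM.
  apply: cvgM; first exact: cvg_cst.
  by apply: cvgB; [exact: cvg_cst|exact: exprn_continuous].
apply: continuous_comp; last exact: sqrt_continuous.
by apply: cvgB; [exact: cvg_cst|exact: exprn_continuous].
Qed.

Lemma measurable_konno_pdf : measurable_fun [set: R] konno_pdf.
Proof.
apply/measurable_restrict => //; rewrite setTI.
apply: open_continuous_measurable_fun; first exact: interval_open.
by move=> x; rewrite inE; exact: konno_pdfT_continuous.
Qed.

Let s := Num.sqrt (1 - r ^+ 2).
Let u (x : R) : R := s * x * (Num.sqrt (r ^+ 2 - x ^+ 2))^-1.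
Let Phi (x : R) : R := pi^-1 * atan (u x).

Let s2 : s ^+ 2 = 1 - r ^+ 2.
Proof. by rewrite sqr_sqrtr// subr_ge0 ltW ?r2_lt1. Qed.

Let s_gt0 : 0 < s.
Proof. by rewrite sqrtr_gt0 subr_gt0 r2_lt1. Qed.

Let is_derive_Phi (x : R) : x \in `]-r, r[ -> is_derive x 1 Phi (konno_pdfT x).
Proof.
move=> /itv_sqr xr.
set w := Num.sqrt (r ^+ 2 - x ^+ 2).
have w0 : 0 < w by rewrite sqrtr_gt0 subr_gt0.
have w2 : w ^+ 2 = r ^+ 2 - x ^+ 2 by rewrite sqr_sqrtr// subr_ge0 ltW.
have dq : is_derive x 1 (fun x : R => r ^+ 2 - x ^+ 2) (- (2 * x)).
  apply: is_derive_eq; rewrite /GRing.scale/=; ring.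
have dw : is_derive x 1 (Num.sqrt \o (fun x : R => r ^+ 2 - x ^+ 2))
    ((2 * w)^-1 * - (2 * x)).
  by apply: (is_derive1_comp _ dq); apply: is_derive1_sqrt; rewrite subr_gt0.
have dV : is_derive x 1 (fun x : R => (Num.sqrt (r ^+ 2 - x ^+ 2))^-1)
    (- w ^- 2 *: ((2 * w)^-1 * - (2 * x))).
  by apply: is_deriveV => //; rewrite gt_eqF.
have du : is_derive x 1 u (s * r ^+ 2 / w ^+ 3).
  have dl : is_derive x 1 (fun x : R => s * x) s.
    by apply: is_derive_eq; rewrite /GRing.scale/=; ring.
  apply: (is_derive_eq (is_deriveM dl dV)); rewrite /GRing.scale/= -/w.
  have -> : r ^+ 2 = w ^+ 2 + x ^+ 2 by rewrite w2; ring.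
  by field; rewrite gt_eqF.
have dA : is_derive x 1 (atan \o u)
   ((1 + u x ^+ 2)^-1 * (s * r ^+ 2 / w ^+ 3)).
  exact: is_derive1_comp.
have dP : is_derive x 1 Phi
    (pi^-1 *: ((1 + u x ^+ 2)^-1 * (s * r ^+ 2 / w ^+ 3))).
  exact: is_deriveZ.
apply: (is_derive_eq dP).
have r2 := r2_lt1; have r0' := r0.
have x1 : 0 < 1 - x ^+ 2 by lra.
rewrite /konno_pdfT -/s -/w /GRing.scale/= /u -/w.
have -> : 1 + (s * x / w) ^+ 2 = r ^+ 2 * (1 - x ^+ 2) / w ^+ 2.
  rewrite expr_div_n exprMn s2.
  have -> : r ^+ 2 * (1 - x ^+ 2) = w ^+ 2 + (1 - r ^+ 2) * x ^+ 2.
    by rewrite w2; ring.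
  by field; rewrite gt_eqF.
have := pi_gt0 R; move: (pi : R) => p p0.
by field; rewrite !gt_eqF.
Qed.

Let a (n : nat) : R := n.+1%:R * r / Num.sqrt (s ^+ 2 + n.+1%:R ^+ 2).

Let den_gt0 n : 0 < s ^+ 2 + n.+1%:R ^+ 2.
Proof. by rewrite addr_gt0 ?exprn_gt0. Qed.

Let a_gt0 n : 0 < a n.
Proof. by rewrite divr_gt0 ?mulr_gt0 ?sqrtr_gt0. Qed.

Let a2 n : a n ^+ 2 = n.+1%:R ^+ 2 * r ^+ 2 / (s ^+ 2 + n.+1%:R ^+ 2).
Proof. by rewrite expr_div_n exprMn (sqr_sqrtr (ltW (den_gt0 n))). Qed.

Let in_aE n (x : R) : (x \in `[- a n, a n]) =
  (s ^+ 2 * x ^+ 2 <= n.+1%:R ^+ 2 * (r ^+ 2 - x ^+ 2)).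
Proof.
have -> : (x \in `[- a n, a n]) = (x ^+ 2 <= a n ^+ 2).
  rewrite in_itv/= -ler_norml -(real_normK (num_real x)).
  by rewrite ler_sqr ?nnegrE ?normr_ge0 ?(ltW (a_gt0 n)).
rewrite a2 ler_pdivlMr//.
by apply/idP/idP; nra.
Qed.

Let aar n (x : R) : x \in `[- a n, a n] -> x \in `]-r, r[.
Proof.
rewrite in_aE => h.
have r0' := r0; have s20 : 0 < s ^+ 2 by rewrite exprn_gt0.
have n20 : 0 < n.+1%:R ^+ 2 :> R by rewrite exprn_gt0.
rewrite in_itv/= -ltr_norml -ltr_sqr ?nnegrE ?normr_ge0 ?(ltW r0)//.
rewrite (real_normK (num_real x)).
have : 0 <= x ^+ 2 by rewrite sqr_ge0.
rewrite le_eqVlt => /predU1P[<-|x20]; first by rewrite exprn_gt0.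
by rewrite -subr_gt0 -(pmulr_rgt0 _ n20); apply: lt_le_trans h; rewrite mulr_gt0.
Qed.

Let u_a n : u (a n) = n.+1%:R.
Proof.
have n0 : 0 < n.+1%:R :> R by [].
have r0' := r0; have s0 := s_gt0.
rewrite /u; have -> : r ^+ 2 - a n ^+ 2 =
    (s * r / Num.sqrt (s ^+ 2 + n.+1%:R ^+ 2)) ^+ 2.
  rewrite a2 expr_div_n exprMn (sqr_sqrtr (ltW (den_gt0 n))).
  have := den_gt0 n; move: (n.+1%:R : R) => N D0.
  by field; rewrite gt_eqF.
rewrite sqrtr_sqr ger0_norm; last by rewrite divr_ge0 ?mulr_ge0 ?sqrtr_ge0 ?ltW.
rewrite /a; have := den_gt0 n; move: (n.+1%:R : R) => N; rewrite -sqrtr_gt0.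
by move: (Num.sqrt _) => D D0; field; rewrite !gt_eqF.
Qed.

Let u_Na n : u (- a n) = - n.+1%:R.
Proof. by rewrite -u_a /u sqrrN mulrN mulNr. Qed.

Let int_a n : (\int[mu]_(x in `[(- a n)%R, (a n)%R]) (konno_pdf x)%:E =
  (2 / pi * atan n.+1%:R)%R%:E)%E.
Proof.
have Ua := a_gt0 n.
have aN : - a n < a n by lra.
have cPhi x : x \in `[- a n, a n] -> {for x, continuous Phi}.
  move=> /aar/is_derive_Phi[dPhi _].
  exact/differentiable_continuous/derivable1_diffP.
transitivity (\int[mu]_(x in `[(- a n)%R, (a n)%R]) (konno_pdfT x)%:E)%E.
  apply: eq_integral => x; rewrite inE => /aar xr.
  by rewrite /konno_pdf patchE ifT// inE.
rewrite (@continuous_FTC2 _ _ Phi)//.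
- by rewrite -EFinB /Phi u_a u_Na atanN mulrN opprK; congr EFin; ring.
- by apply: continuous_in_subspaceT => x; rewrite inE => /aar /konno_pdfT_continuous.
- split.
  + move=> x xa; have /is_derive_Phi[//] : x \in `]-r, r[.
    by apply: (@aar n); exact: subset_itv_oo_cc xa.
  + by apply: cvg_at_right_filter; apply: cPhi; rewrite in_itv/= lexx ltW.
  + by apply: cvg_at_left_filter; apply: cPhi; rewrite in_itv/= lexx ltW.
- move=> x xa; have /is_derive_Phi dP : x \in `]-r, r[.
    by apply: (@aar n); exact: subset_itv_oo_cc xa.
  by rewrite derive1E derive_val.
Qed.

Let bigcup_a : \bigcup_n [set` `[- a n, a n]] = [set` `]-r, r[].
Proof.
apply/seteqP; split => [x [n _]/= /aar//|x /= /itv_sqr xr].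
have q0 : 0 < r ^+ 2 - x ^+ 2 by rewrite subr_gt0.
pose t := s ^+ 2 * x ^+ 2 / (r ^+ 2 - x ^+ 2).
have t0 : 0 <= t.
  by apply: divr_ge0; [apply: mulr_ge0; exact: sqr_ge0|exact: ltW].
exists (Num.bound t) => //=; rewrite in_aE -ler_pdivrMr// -/t.
have := archi_boundP t0; set N := Num.bound t => tN.
have : (N%:R : R) <= N.+1%:R by rewrite ler_nat.
have : (1 : R) <= N.+1%:R by rewrite ler1n.
by nra.
Qed.

Let nd_a : nondecreasing_seq (fun n => [set` `[- a n, a n]]).
Proof.
move=> m n mn; rewrite subsetEset => x /=.
move=> /[dup] /aar /itv_sqr xr; rewrite !in_aE => /le_trans; apply.
apply: ler_wpM2r; first by rewrite subr_ge0 ltW.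
by apply: lerXn2r; rewrite ?nnegrE// ler_nat.
Qed.

Lemma integral_konno_pdf : (\int[mu]_x (konno_pdf x)%:E = 1)%E.
Proof.
have -> : (\int[mu]_x (konno_pdf x)%:E =
    \int[mu]_(x in `](- r)%R, r[) (konno_pdf x)%:E)%E.
  rewrite [RHS]integral_mkcond/=; apply: eq_integral => x _.
  by rewrite patchE; case: ifPn => //; rewrite /konno_pdf patchE => /negbTE ->.
rewrite -bigcup_a.
have c1 : (\int[mu]_(x in `[(- a n)%R, (a n)%R]) (konno_pdf x)%:E)%E
    @[n --> \oo] --> (\int[mu]_(x in \bigcup_n `[(- a n)%R, (a n)%R]%classic)
      (konno_pdf x)%:E)%E.
  apply: ge0_nondecreasing_set_cvg_integral => //.
  - by move=> n; apply/measurable_EFinP/measurable_funTS; exact: measurable_konno_pdf.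
  - by move=> n x _; rewrite lee_fin konno_pdf_ge0.
have c2 : (\int[mu]_(x in `[(- a n)%R, (a n)%R]) (konno_pdf x)%:E)%E
    @[n --> \oo] --> 1%E.
  under eq_cvg do rewrite int_a.
  apply: cvg_EFin; first exact: nearW.
  rewrite [X in _ --> X](_ : _ = 2 / pi * (pi / 2) :> R); last first.
    have := pi_gt0 R; move: (pi : R) => p p0.
    by field; rewrite gt_eqF.
  apply: cvgM; first exact: cvg_cst.
  apply: (@cvg_comp _ _ _ (fun n : nat => n.+1%:R : R) atan); last exact: cvgy_atan.
  by have := @cvgr_idn R; rewrite -(cvg_shiftS (fun n => n%:R : R)).
exact: cvg_unique c1 c2.
Qed.

End konno_pdf.

(* The proof that 0 < r < 1 is an argument because only for such r is the set
   function below a probability measure. *)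
Definition konno {R : realType} (r : R) (r01 : 0 < r < 1) :
    set (measurableTypeR R) -> \bar R :=
  fun A => (\int[lebesgue_measure]_(x in A) (konno_pdf r x)%:E)%E.

Section konno_probability.
Context {R : realType} (r : R) (r01 : 0 < r < 1).

Let konno0 : konno r01 set0 = 0%E.
Proof. by rewrite /konno integral_set0. Qed.

Let konno_ge0 A : (0 <= konno r01 A)%E.
Proof. by apply: integral_ge0 => x _; rewrite lee_fin konno_pdf_ge0. Qed.

Let konno_sigma_additive : semi_sigma_additive (konno r01).
Proof.
move=> /= F mF tF mUF; rewrite /konno; apply: cvg_toP.
  apply: ereal_nondecreasing_is_cvgn => m n mn.
  apply: lee_sum_nneg_natr => // k _ _.
  by apply: integral_ge0 => x _; rewrite lee_fin konno_pdf_ge0.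
rewrite ge0_integral_bigcup//=.
- by apply/measurable_EFinP/measurable_funTS; exact: measurable_konno_pdf.
- by move=> x _; rewrite lee_fin konno_pdf_ge0.
Qed.

HB.instance Definition _ := isMeasure.Build _ _ _
  (konno r01) konno0 konno_ge0 konno_sigma_additive.

Let konno_setT : konno r01 [set: _] = 1%E.
Proof. exact: integral_konno_pdf. Qed.

HB.instance Definition _ :=
  @Measure_isProbability.Build _ _ R (konno r01) konno_setT.

End konno_probability.

Section boolean_convolution.
Context {R : realType}.
Local Open Scope complex_scope.
Implicit Types (mu nu rho : probability (measurableTypeR R) R) (c : R).

(* Integral of a complex-valued function: real and imaginary parts are
   integrated separately. *)
Definition Cintegral mu (f : R -> R[i]) : R[i] :=
  (\int[mu]_x complex.Re (f x)) +i* (\int[mu]_x complex.Im (f x)).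

Definition cauchy_transform mu (z : R[i]) : R[i] :=
  Cintegral mu (fun x => (z - x%:C)^-1).

Definition F_transform mu (z : R[i]) : R[i] := (cauchy_transform mu z)^-1.

(* rho = mu \uplus nu: the Boolean convolution is the probability measure
   characterized by this identity on the upper half-plane. *)
Definition is_boolean_convolution mu nu rho : Prop :=
  forall z : R[i], 0 < complex.Im z ->
    F_transform rho z = F_transform mu z + F_transform nu z - z.

Definition scale_fun c : measurableTypeR R -> measurableTypeR R :=
  fun x : R => c * x.

Lemma measurable_scale_fun c : measurable_fun [set: _] (scale_fun c).
Proof. exact: measurable_funM. Qed.

HB.instance Definition _ c :=
  isMeasurableFun.Build _ _ _ _ (scale_fun c) (measurable_scale_fun c).

Definition dilation c mu : probability (measurableTypeR R) R :=
  distribution mu (scale_fun c).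

Definition boolean_self_decomposable mu : Prop :=
  forall c, 0 < c < 1 ->
    exists mu_c : probability (measurableTypeR R) R,
      is_boolean_convolution (dilation c mu) mu_c mu.

End boolean_convolution.

(* Main.v *)
From HB Require Import structures.
Require Import Defs.
From mathcomp Require Import all_boot all_order all_algebra.
From mathcomp Require Import spectral sesquilinear.
From mathcomp Require Import all_classical all_reals all_analysis.
From mathcomp Require Import measurable_realfun complex ring lra.

Set Implicit Arguments.
Unset Strict Implicit.
Unset Printing Implicit Defensive.

Import Order.TTheory GRing.Theory Num.Theory.
Import numFieldNormedType.Exports.
Local Open Scope classical_set_scope.
Local Open Scope ring_scope.

(** Write F for the reciprocal of the Cauchy transform. The law mu_c asked for
must satisfy F_{mu_c}(z) = z - (E_1(z) - E_c(z)), where E_c(z) stands for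
z - F(z) taken for the dilated law D_c(K_r), and E_1 is the case of K_r itself.

A function z - int g(x) / (z - x) dx, with g nonnegative, integrable and of
bounded support, is always the F of a probability measure
([nevanlinna_compact_support]). It is therefore enough to write E_c as the
Cauchy transform of a density rho_c such that rho_c <= rho_1. With
s = sqrt (1 - r^2) and w = sqrt (z^2 - c^2 r^2), Im w > 0, one finds

  E_c(z) = c^2 r^2 / (z + s w),
  rho_c(x) = s c^2 / pi * sqrt (c^2 r^2 - x^2) / (x^2 + c^2 s^2),

and rho_c(x) is visibly nondecreasing in c ([nevanlinna_density_le]).

The two Cauchy transforms that this needs, those of the Konno density and of
rho_c, reduce by partial fractions to that of the arcsine density, which is 1/w
([arcsine_transform]). The latter is obtained from a primitive: the even part of
the integrand becomes a rational function of t = x / sqrt (a^2 - x^2), with two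
simple poles, and its primitive is a combination of ln and atan.

The existence of a measure with a prescribed F first comes from linear algebra.
For a measure with finitely many atoms, z - sum_j s_j / (z - x_j) is the
reciprocal of a diagonal entry of the resolvent of a Hermitian arrow matrix, and
the spectral theorem turns that entry into sum_k w_k / (z - d_k) with weights
w_k >= 0 of sum 1 ([arrow_mx_spectral]). A density g is then approximated by
finitely many atoms; the corresponding probability measures all live on one
bounded interval, so that a limit exists by Helly's selection theorem ([helly]),
and Cauchy kernels, being Lipschitz, pass to the limit. *)

(** * Resolvent of an arrow matrix *)

Section arrow_matrix.
Local Open Scope sesquilinear_scope.
Context {C : numClosedFieldType} {n : nat}.
Variables b x : 'I_n -> C.
Hypotheses (bR : forall j, b j \is Num.real) (xR : forall j, x j \is Num.real).

Definition arrow_mx : 'M[C]_n.+1 := \matrix_(i, j)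
  match unlift ord0 i, unlift ord0 j with
  | None, None => 0
  | Some i', None => b i'
  | None, Some j' => b j'
  | Some i', Some j' => x i' *+ (i' == j')
  end.

Let A00 : arrow_mx 0 0 = 0.
Proof. by rewrite mxE unlift_none. Qed.

Let A0l j : arrow_mx 0 (lift 0 j) = b j.
Proof. by rewrite mxE unlift_none liftK. Qed.

Let Al0 i : arrow_mx (lift 0 i) 0 = b i.
Proof. by rewrite mxE unlift_none liftK. Qed.

Let All i j : arrow_mx (lift 0 i) (lift 0 j) = x i *+ (i == j).
Proof. by rewrite mxE !liftK. Qed.

Lemma arrow_mx_hermitian : arrow_mx \is hermsymmx.
Proof.
apply: realsym_hermsym; last first.
  apply/mxOverP => i j; rewrite mxE.
  case: unliftP => [i' _|_]; case: unliftP => [j' _|_] //=; exact: rpredMn.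
apply/is_hermitianmxP; rewrite expr0 scale1r map_mx_id//.
apply/matrixP => i j; rewrite !mxE.
case: unliftP => [i' _|_]; case: unliftP => [j' _|_] //=.
by rewrite eq_sym; case: eqP => // ->.
Qed.

Let P := spectralmx arrow_mx.
Let d : 'I_n.+1 -> C := spectral_diag arrow_mx 0.

Let rowE k j : \sum_i P k i * arrow_mx i j = d k * P k j.
Proof.
have /hermitian_normalmx/orthomx_spectralP := arrow_mx_hermitian.
rewrite -/P => /(congr1 (mulmx P)).
rewrite !mulmxA mulmxV ?spectral_unit// mul1mx => /matrixP/(_ k j).
by rewrite mul_diag_mx !mxE.
Qed.

Let row0E k : \sum_j P k (lift 0 j) * b j = d k * P k 0.
Proof.
rewrite -rowE big_ord_recl A00 mulr0 add0r.
by apply: eq_bigr => j _; rewrite Al0.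
Qed.

Let rowlE k j : P k 0 * b j + P k (lift 0 j) * x j = d k * P k (lift 0 j).
Proof.
rewrite -rowE big_ord_recl A0l; congr (_ + _).
rewrite (bigD1 j)//= All eqxx big1 ?addr0// => i ij.
by rewrite All (negbTE ij) mulr0.
Qed.

Let dR k : d k \is Num.real.
Proof. by have /mxOverP := hermitian_spectral_diag_real arrow_mx_hermitian; apply. Qed.

Let PPt k : \sum_i P k i * (P k i)^* = 1.
Proof.
have /unitarymxP/matrixP/(_ k k) := spectral_unitarymx arrow_mx.
rewrite !mxE eqxx mulr1n => <-.
by apply: eq_bigr => i _; rewrite !mxE.
Qed.

Let PtP i j : \sum_k (P k i)^* * P k j = (i == j)%:R.
Proof.
have /matrixP/(_ i j) := mulVmx (spectral_unit arrow_mx).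
rewrite (invmx_unitary (spectral_unitarymx _)) !mxE => <-.
by apply: eq_bigr => k _; rewrite !mxE.
Qed.

(** Diagonalize the matrix as P^* D P. The entry (0, 0) of its resolvent at z is
the sum of |P_k0|^2 / (z - d_k); eliminating the coordinates other than 0, it is
also the inverse of z - sum_j b_j^2 / (z - x_j). The secular equation for d_k,
obtained by the same elimination in an eigenvector, serves to bound the
eigenvalues. *)
Lemma arrow_mx_spectral : exists w d : 'I_n.+1 -> C,
  [/\ forall k, 0 <= w k, \sum_k w k = 1, forall k, d k \is Num.real,
      forall k, (forall j, d k != x j) -> d k = \sum_j b j ^+ 2 / (d k - x j) &
      forall z, z \isn't Num.real ->
        \sum_k w k / (z - d k) = (z - \sum_j b j ^+ 2 / (z - x j))^-1].
Proof.
exists (fun k => (P k 0)^* * P k 0), d; split => //=.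
- by move=> k; rewrite mulrC mul_conjC_ge0.
- move=> k dx.
  have Pl j : P k (lift 0 j) = P k 0 * b j / (d k - x j).
    apply: canRL (mulfK _) _; first by rewrite subr_eq0.
    by rewrite mulrBr [_ * d k]mulrC -rowlE addrK.
  have P0 : P k 0 != 0.
    apply/eqP => P0; have := PPt k; rewrite big1 => [/eqP|i _].
      by rewrite eq_sym oner_eq0.
    by case: (unliftP 0 i) => [j|] ->; rewrite ?Pl P0 !mul0r.
  apply: (mulIf P0); rewrite -row0E mulr_suml; apply: eq_bigr => j _.
  by rewrite Pl; ring.
- move=> z zR.
  have zN y : y \is Num.real -> z - y != 0.
    by move=> yR; rewrite subr_eq0; apply: contraNneq zR => ->.
  set S := z - _.
  (* v solves (z - A) v = S e_0, where A is the arrow matrix. *)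
  pose v i := if unlift 0 i is Some j then b j / (z - x j) else 1 : C.
  have v0 : v 0 = 1 by rewrite /v unlift_none.
  have vl j : v (lift 0 j) = b j / (z - x j) by rewrite /v liftK.
  have zu k : (z - d k) * \sum_i P k i * v i = S * P k 0.
    rewrite mulrBl [d k * _]mulr_sumr.
    under [X in _ - X]eq_bigr do rewrite mulrA -rowE.
    rewrite mulr_sumr -sumrB big_ord_recl v0 !mulr1.
    rewrite big_ord_recl A00 mulr0 add0r.
    under [X in _ - X + _]eq_bigr do rewrite Al0.
    have -> : \sum_(i < n) (z * (P k (lift ord0 i) * v (lift ord0 i)) -
       (\sum_(i0 < n.+1) P k i0 * arrow_mx i0 (lift ord0 i)) * v (lift ord0 i)) =
       \sum_(i < n) (P k (lift 0 i) * b i - P k 0 * (b i ^+ 2 / (z - x i))).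
      apply: eq_bigr => j _; rewrite rowE -rowlE vl.
      have := zN _ (xR j); move: (z - x j) (subrK (x j) z) => y <- y0.
      rewrite -[LHS]mulr1 -[X in _ * X = _](divff y0) -[in RHS](mulfK y0 (_ * b j)).
      by rewrite expr2; field.
    rewrite sumrB -mulr_sumr /S mulrBl [P k 0 * _]mulrC addrA; congr (_ - _).
    by rewrite subrK.
  have inv i : \sum_k (P k i)^* * (\sum_j P k j * v j) = v i.
    under eq_bigr do rewrite mulr_sumr.
    rewrite exchange_big/= (bigD1 i)//= [X in _ + X]big1 => [|j ij].
      rewrite addr0; under eq_bigr do rewrite mulrA.
      by rewrite -mulr_suml PtP eqxx mul1r.
    under eq_bigr do rewrite mulrA.
    by rewrite -mulr_suml PtP eq_sym (negbTE ij) mul0r.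
  have S1 : S * (\sum_k (P k 0)^* * P k 0 / (z - d k)) = 1.
    rewrite -v0 -inv mulr_sumr; apply: eq_bigr => k _.
    have := zN _ (dR k) => zd; apply: (mulIf zd).
    by rewrite -[RHS]mulrA [_ * (z - d k) in RHS]mulrC zu; field.
  have S0 : S != 0 by apply: contra_eq_neq S1 => ->; rewrite mul0r eq_sym oner_eq0.
  by apply: (mulfI S0); rewrite S1 divff.
Qed.

End arrow_matrix.

(** * Helly selection on a bounded interval *)

(** An ultrafilter replaces the extraction of a subsequence: along it the
distribution functions of a sequence of measures converge at all points at
once. *)
Lemma ultra_cvg_bounded {R : realType} {T : Type} (U : set_system T)
    (u : T -> R) (a b : R) :
  UltraFilter U -> (forall t, a <= u t <= b) -> exists l : R, u t @[t --> U] --> l.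
Proof.
move=> UU uab; have FU : ProperFilter (u @ U) by exact: fmap_proper_filter.
have /(_ (u @ U) FU) := @segment_compact R a b.
case=> [|p [_ clp]]; first by apply: (@filterE _ U) => t; rewrite /= in_itv; exact: uab.
exists p => V Vp.
have [//|UC] := in_ultra_setVsetC (u @^-1` V) UU.
have [x [Cx Vx]] := clp (~` V) V UC Vp.
by case: (Cx Vx).
Qed.

Section right_regularization.
Context {R : realType}.
Variables (Phi : R -> R) (A : R).
Hypotheses (ndPhi : {homo Phi : x y / x <= y}).
Hypotheses (Phi0 : forall x : R, x <= - A -> Phi x = 0).
Hypotheses (Phi1 : forall x, A <= x -> Phi x = 1).

Let Phi_ge0 x : 0 <= Phi x.
Proof.
by rewrite -(Phi0 (_ : Num.min x (- A) <= - A)) ?ge_min ?lexx ?orbT// ndPhi// ge_min lexx.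
Qed.

(** A pointwise limit of distribution functions is monotone but it may fail to be
right-continuous; its limit from the right is the distribution function of the
limit measure. *)
Definition right_reg (x : R) : R := inf [set Phi y | y in `]x, +oo[].

Let right_reg_has_inf x : has_inf [set Phi y | y in `]x, +oo[].
Proof.
split; first by exists (Phi (x + 1)), (x + 1); rewrite // /= in_itv/= andbT; lra.
by exists 0 => _ [y _ <-]; exact: Phi_ge0.
Qed.

Lemma right_reg_le x y : x < y -> right_reg x <= Phi y.
Proof.
move=> xy; apply: ge_inf; first by case: (right_reg_has_inf x).
by exists y; rewrite // /= in_itv/= andbT.
Qed.

Lemma le_right_reg x : Phi x <= right_reg x.
Proof.
apply: lb_le_inf; first by case: (right_reg_has_inf x).
by move=> _ [y + <-]; rewrite /= in_itv/= andbT => /ltW/ndPhi.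
Qed.

Let right_reg_nd : {homo right_reg : x y / x <= y}.
Proof.
move=> x y; rewrite le_eqVlt => /predU1P[->//|xy].
by rewrite (le_trans (right_reg_le xy))// le_right_reg.
Qed.

Let right_reg_rc (x : R) : right_reg y @[y --> x^'+] --> right_reg x.
Proof.
apply/cvgrPdist_lt => e e0.
have [_ [y + <-] ye] := inf_adherent e0 (right_reg_has_inf x).
rewrite /= in_itv/= andbT => xy.
near=> t.
have xt : x <= t by near: t; exact: nbhs_right_ge.
rewrite distrC ger0_norm ?subr_ge0 ?right_reg_nd// ltrBlDl.
apply: le_lt_trans ye; apply: right_reg_le.
by near: t; exact: nbhs_right_lt.
Unshelve. all: by end_near. Qed.

Lemma right_reg0 x : x < - A -> right_reg x = 0.
Proof.
move=> xA; apply/eqP; rewrite eq_le -{2}(Phi0 (ltW xA)) le_right_reg.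
by rewrite -(Phi0 (lexx (- A))) right_reg_le.
Qed.

Lemma right_reg1 x : A <= x -> right_reg x = 1.
Proof.
move=> xA; apply/eqP; rewrite eq_le -{2}(Phi1 xA) le_right_reg.
have x1 : x < x + 1 by lra.
by rewrite -(Phi1 (le_trans xA (ltW x1))) right_reg_le.
Qed.

HB.instance Definition _ :=
  isCumulative.Build R _ R right_reg right_reg_nd right_reg_rc.

Let right_regNy : right_reg x @[x --> -oo] --> (0 : R).
Proof.
apply/cvgrPdist_lt => e e0; near=> x.
rewrite right_reg0 ?subrr ?normr0//.
by near: x; apply: nbhs_ninfty_lt; rewrite num_real.
Unshelve. all: by end_near. Qed.

Let right_regy : right_reg x @[x --> +oo] --> (1 : R).
Proof.
apply/cvgrPdist_lt => e e0; near=> x.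
rewrite right_reg1 ?subrr ?normr0//.
Unshelve. all: by end_near. Qed.

HB.instance Definition _ :=
  isCumulativeBounded.Build R 0 1 right_reg right_regNy right_regy.

Lemma right_reg_probability : exists Q : probability (measurableTypeR R) R,
  forall x, Q `]-oo, x]%classic = (right_reg x)%:E.
Proof.
exists (lebesgue_stieltjes_measure right_reg) => x.
exact: cdf_lebesgue_stieltjes_id.
Qed.

End right_regularization.


Lemma integrable_bounded_mul {R : realType} (mu : {measure set (measurableTypeR R) -> \bar R})
    (f g : R -> R) (B : R) (D : set (measurableTypeR R)) :
  measurable D -> measurable_fun (setT : set (measurableTypeR R)) f ->
  (forall x, `|f x| <= B) ->
  mu.-integrable setT (EFin \o g) -> mu.-integrable D (EFin \o (fun x => f x * g x)).
Proof.
move=> mD mf fB ig.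
apply: (@integrableS _ _ _ _ setT) => //.
have bB : [bounded f x | x in (setT : set (measurableTypeR R))].
  exists B; split; first by rewrite num_real.
  by move=> x Bx y _; exact: le_trans (fB y) (ltW Bx).
by have := integrableMr measurableT mf bB ig; apply: eq_integrable.
Qed.

Lemma integrable_bounded {R : realType}
    (P : probability (measurableTypeR R) R) (f : R -> R) (B : R) :
  measurable_fun (setT : set (measurableTypeR R)) f ->
  (forall x, `|f x| <= B) -> P.-integrable setT (EFin \o f).
Proof.
move=> mf fB; apply: measurable_bounded_integrable => //.
  by rewrite (le_lt_trans (probability_le1 P _)) ?ltry.
exists B; split; first by rewrite num_real.
by move=> x Bx y _; exact: le_trans (fB y) (ltW Bx).
Qed.

Section riemann_stieltjes_sum.
Context {R : realType}.
Local Notation RT := (measurableTypeR R).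
Variables (mu : {measure set RT -> \bar R}) (f g : R -> R) (B L : R).
Hypotheses (g0 : forall x, 0 <= g x) (ig : mu.-integrable setT (EFin \o g)).
Hypotheses (mf : measurable_fun (setT : set RT) f) (fB : forall x, `|f x| <= B).
Hypothesis fL : forall x y, `|f x - f y| <= L * `|x - y|.
Variables (a h : R).
Hypothesis h0 : 0 <= h.
Let t n : R := a + n%:R * h.

Let t_le m n : (m <= n)%N -> t m <= t n.
Proof. by move=> mn; rewrite lerD2l ler_wpM2r// ler_nat. Qed.

Let igD (D : set RT) : measurable D -> mu.-integrable D (EFin \o g).
Proof. by move=> mD; exact: integrableS ig. Qed.

(** On each cell f varies by at most L * h. The integrand carries a weight g so that
the same bound covers a probability measure (with g = 1) and a finite measure
with a density. *)
Lemma riemann_stieltjes_sum n :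
  `|\int[mu]_(x in `]a, t n]) (f x * g x) -
    \sum_(0 <= i < n) f (t i.+1) * \int[mu]_(x in `]t i, t i.+1]) g x|
  <= L * h * \int[mu]_(x in `]a, t n]) g x.
Proof.
have ta : a = t 0 by rewrite /t mul0r addr0.
elim: n => [|n IHn].
  by rewrite -ta big_nil set_itvoc0 !Rintegral_set0 !subrr normr0 mulr0.
have mI : measurable (`]t n, t n.+1]%classic : set RT) by [].
have ifg (D : set RT) : measurable D -> mu.-integrable D (EFin \o (fun x => f x * g x)).
  by move=> mD; exact: integrable_bounded_mul mf fB ig.
have cell : `|\int[mu]_(x in `]t n, t n.+1]) (f x * g x) -
    f (t n.+1) * \int[mu]_(x in `]t n, t n.+1]) g x|
    <= L * h * \int[mu]_(x in `]t n, t n.+1]) g x.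
  have icg (c : R) : mu.-integrable `]t n, t n.+1] (EFin \o (fun x => c * g x)).
    by apply: (@integrable_bounded_mul _ _ (cst c) _ `|c|).
  have intB : mu.-integrable `]t n, t n.+1]
      (EFin \o (fun x => f x * g x - f (t n.+1) * g x)).
    by have := integrableB mI (ifg _ mI) (icg (f (t n.+1))); apply: eq_integrable.
  rewrite -!RintegralZl ?igD// -RintegralB//; [|exact: ifg].
  apply: le_trans; first exact: le_normr_Rintegral.
  apply: le_Rintegral => //=; [exact: integrable_norm intB|].
  move=> x /=; rewrite in_itv/= => /andP[tx xt].
  rewrite -mulrBl normrM (ger0_norm (g0 x)) ler_wpM2r// (le_trans (fL _ _))//.
  have L0 : 0 <= L.
    by have := le_trans (normr_ge0 _) (fL 1 0); rewrite subr0 normr1 mulr1.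
  rewrite ler_wpM2l// ler0_norm; last by lra.
  have : t n.+1 = t n + h by rewrite /t -natr1; ring.
  by lra.
have ab : `]a, t n.+1]%classic = `]a, t n] `|` `]t n, t n.+1] :> set R.
  apply: itv_bndbnd_setU; rewrite bnd_simp ?t_le//.
  by rewrite [leLHS]ta t_le.
have dab : [disjoint (`]a, t n]%classic : set RT) & `]t n, t n.+1]%classic].
  apply/disj_set2P/seteqP; split => // x [] /=; rewrite !in_itv/=.
  by move=> /andP[_ xt] /andP[]; rewrite ltNge xt.
rewrite ab !Rintegral_setU//=; do ?by rewrite -ab; auto.
rewrite big_nat_recr//=; rewrite opprD addrACA (le_trans (ler_normD _ _))//.
by rewrite mulrDr lerD.
Qed.

End riemann_stieltjes_sum.

Lemma itv_oc_setD {R : realType} (x y : R) :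
  `]x, y]%classic = `]-oo, y] `\` `]-oo, x] :> set R.
Proof. by rewrite -[RHS]setCK setCD setCitvl setUC -[LHS]setCK setCitv. Qed.

Section helly.
Context {R : realType}.
Local Notation RT := (measurableTypeR R).

Lemma Rintegral_probability1 (P : probability RT R) (f : R -> R) (B : R) D :
  measurable D -> P D = 1%E ->
  measurable_fun (setT : set RT) f -> (forall x, `|f x| <= B) ->
  \int[P]_x f x = \int[P]_(x in D) f x.
Proof.
move=> mD PD mf fB.
have PDC : P (~` D) = 0%E by rewrite probability_setC// PD subee.
rewrite -(setUv D) Rintegral_setU//; first last.
- by apply/disj_set2P; rewrite setICr.
- by rewrite setUv; exact: integrable_bounded fB.
- exact: measurableC.
rewrite [X in _ + X](_ : _ = 0) ?addr0// /Rintegral null_set_integral//.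
- exact: measurableC.
- by apply/measurable_EFinP; exact: measurable_funTS.
Qed.

(** Along an ultrafilter the distribution functions of the P n converge to some Phi,
and Q is the measure whose distribution function is G, the right regularization
of Phi. The integral of f against P n or Q is within L * h of its Riemann-Stieltjes
sum of mesh h, and the sums built on Phi and on G differ by at most L * h as well:
G - Phi at a node is at most the increment of Phi over the next cell. Asking for
the limit l of the whole sequence keeps the ultrafilter out of the
statement. *)
Lemma helly (M : R) (P : nat -> probability RT R) :
  (forall n, P n `]- M, M]%classic = 1%E) ->
  exists Q : probability RT R, forall (f : R -> R) (B L l : R),
    measurable_fun (setT : set RT) f -> (forall x, `|f x| <= B) ->
    (forall x y, `|f x - f y| <= L * `|x - y|) ->
    \int[P n]_x f x @[n --> \oo] --> l -> \int[Q]_x f x = l.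
Proof.
move=> PM.
have M0 : 0 < M.
  rewrite ltNge; apply/negP => M0; have := PM 0%N.
  rewrite set_itv_ge ?measure0; last by rewrite bnd_simp -leNgt; lra.
  by move=> /esym/eqP; rewrite onee_eq0.
pose F n x := fine (P n `]-oo, x]%classic).
have PF n x : P n `]-oo, x]%classic = (F n x)%:E.
  by rewrite fineK ?fin_num_measure.
have ndF n : {homo F n : x y / x <= y}.
  move=> x y xy; rewrite -lee_fin -!PF le_measure ?inE//.
  by apply: subset_itvl; rewrite bnd_simp.
have F01 n x : 0 <= F n x <= 1.
  by rewrite -!lee_fin -PF measure_ge0 probability_le1.
have F0 n x : x <= - M -> F n x = 0.
  move=> xM; apply/eqP; rewrite eq_le; have /andP[-> _] := F01 n x.
  rewrite andbT -lee_fin -PF -(@leeD2rE _ 1)// add0e -{1}(PM n) -measureU//.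
    by rewrite probability_le1//; exact: measurableU.
  apply/seteqP; split => // y [] /=; rewrite !in_itv/= => yx /andP[+ _].
  by rewrite ltNge (le_trans yx).
have F1 n x : M <= x -> F n x = 1.
  move=> Mx; apply/eqP; rewrite eq_le; have /andP[_ ->] /= := F01 n x.
  rewrite -lee_fin -PF -(PM n) le_measure ?inE//.
  by move=> y; rewrite /= !in_itv/= => /andP[_ /le_trans]; apply.
have [U [UU ooU]] := ultraFilterLemma (@eventually_filter).
have /choice[Phi cvgPhi] : forall x, exists l : R, F n x @[n --> U] --> l.
  by move=> x; exact: (ultra_cvg_bounded UU (F01 ^~ x)).
have ndPhi : {homo Phi : x y / x <= y}.
  move=> x y xy; apply: (ler_cvg_to (cvgPhi x) (cvgPhi y)).
  by apply: filterE => n; exact: ndF.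
have Phi_cst (c x : R) : (forall n, F n x = c) -> Phi x = c.
  move=> Fc; apply/esym/(cvg_unique _ _ (cvgPhi x)) => //=.
  by under eq_fun do rewrite Fc; exact: cvg_cst.
have Phi0 x : x <= - M -> Phi x = 0 by move=> xM; apply: Phi_cst => n; exact: F0.
have Phi1 x : M <= x -> Phi x = 1 by move=> xM; apply: Phi_cst => n; exact: F1.
have [Q QE] := right_reg_probability ndPhi Phi0 Phi1.
exists Q => f B L l mf fB fL Pfl.
have L0 : 0 <= L.
  by have := le_trans (normr_ge0 _) (fL 1 0); rewrite subr0 normr1 mulr1.
pose G := right_reg Phi.
(* The margin of 1 at each end makes Phi and G agree there (both 0, then both 1). *)
pose a := - M - 1.
suff key (N : nat) (h := 2 * (M + 1) / N.+1%:R) :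
    `|\int[Q]_x f x - l| <= 3 * L * h.
  apply/eqP; rewrite -subr_eq0 -normr_le0 leNgt; apply/negP => e0.
  set e := `|_| in key e0.
  have := archi_boundP (_ : 0 <= 6 * L * (M + 1) / e).
  rewrite divr_ge0 ?mulr_ge0//; [move=> /(_ erefl)|lra|exact: ltW].
  set N := Num.bound _ => Nb; have := key N.
  apply/negP; rewrite -ltNge.
  have -> : 3 * L * (2 * (M + 1) / N.+1%:R) = 6 * L * (M + 1) / N.+1%:R by ring.
  rewrite ltr_pdivrMr//; rewrite ltr_pdivrMr// in Nb.
  by rewrite (lt_trans Nb)// mulrC ltr_pM2l// ltr_nat.
pose t n := a + n%:R * h.
have h0 : 0 < h by rewrite divr_gt0// mulr_gt0//; lra.
have tN : t N.+1 = M + 1.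
  by rewrite /t /h /a mulrCA divff ?pnatr_eq0// mulr1; ring.
have t0 : t 0%N = a by rewrite /t mul0r addr0.
have tS i : t i.+1 = t i + h by rewrite /t -natr1; ring.
pose S (H : R -> R) := \sum_(0 <= i < N.+1) f (t i.+1) * (H (t i.+1) - H (t i)).
have RS (P' : probability RT R) (H : R -> R) :
    (forall x, P' `]-oo, x]%classic = (H x)%:E) -> H a = 0 -> H (M + 1) = 1 ->
    `|\int[P']_x f x - S H| <= L * h.
  move=> PH Ha HM.
  have P1 : P' `]a, t N.+1]%classic = 1%E.
    rewrite itv_oc_setD measureD ?setIidr//.
    - transitivity ((H (t N.+1))%:E - (H a)%:E)%E; last by rewrite tN Ha HM sube0.
      by congr (_ - _)%E; exact: PH.
    - by apply: subset_itvl; rewrite bnd_simp tN /a; lra.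
    - by rewrite (le_lt_trans (probability_le1 P' _)) ?ltry.
  have HE x y : x <= y -> \int[P']_(_ in `]x, y]) 1 = H y - H x.
    move=> xy; rewrite Rintegral_cst// mul1r itv_oc_setD measureD ?setIidr//.
    - transitivity (fine ((H y)%:E - (H x)%:E)%E); last by [].
      by congr (fine (_ - _)); exact: PH.
    - by apply: subset_itvl; rewrite bnd_simp.
    - by rewrite (le_lt_trans (probability_le1 P' _)) ?ltry.
  rewrite (Rintegral_probability1 _ P1 mf fB)//.
  have := @riemann_stieltjes_sum R P' f (cst 1) B L (fun=> ler01)
    (finite_measure_integrable_cst _ _ measurableT) mf fB fL a h (ltW h0) N.+1.
  rewrite -/(t _) HE; last by rewrite tN /a; lra.
  rewrite tN HM Ha subr0 mulr1; congr (`|_ - _| <= _).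
    by apply: eq_Rintegral => x _; rewrite mulr1.
  apply: eq_bigr => i _; rewrite -/(t i) -/(t i.+1) HE// tS; lra.
have SG : `|S G - S Phi| <= L * h.
  have Jge0 i : 0 <= G i - Phi i by rewrite subr_ge0 (le_right_reg ndPhi Phi0).
  (* Summation by parts; as G (t i) <= Phi (t i.+1), the error terms are
     bounded by L * h times increments of Phi, which telescope. *)
  have abel n : `|\sum_(0 <= i < n) f (t i.+1) *
      ((G (t i.+1) - Phi (t i.+1)) - (G (t i) - Phi (t i)))
      - f (t n) * (G (t n) - Phi (t n))| <= L * h * Phi (t n).
    elim: n => [|n IHn].
      rewrite big_nil t0 Phi0 ?/a; last lra.
      by rewrite /G (right_reg0 ndPhi Phi0) ?/a ?subr0 ?mulr0 ?subr0 ?normr0//; lra.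
    rewrite big_nat_recr//=.
    rewrite (_ : _ - _ = (\sum_(0 <= i < n) f (t i.+1) *
      ((G (t i.+1) - Phi (t i.+1)) - (G (t i) - Phi (t i)))
      - f (t n) * (G (t n) - Phi (t n))) +
      (f (t n) - f (t n.+1)) * (G (t n) - Phi (t n))); last by ring.
    rewrite (le_trans (ler_normD _ _))//.
    have -> : L * h * Phi (t n.+1) =
      L * h * Phi (t n) + L * h * (Phi (t n.+1) - Phi (t n)) by ring.
    rewrite lerD// normrM ler_pM//.
      by rewrite (le_trans (fL _ _))// tS opprD addNKr normrN gtr0_norm.
    rewrite ger0_norm ?Jge0// lerB// (right_reg_le ndPhi Phi0)// tS; lra.
  have -> : S G - S Phi = \sum_(0 <= i < N.+1) f (t i.+1) *
      ((G (t i.+1) - Phi (t i.+1)) - (G (t i) - Phi (t i)))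
      - f (t N.+1) * (G (t N.+1) - Phi (t N.+1)).
    rewrite tN Phi1 ?/G ?(right_reg1 ndPhi Phi0 Phi1); [|lra..]; rewrite subrr mulr0 subr0.
    by rewrite -sumrB; apply: eq_bigr => i _; ring.
  by apply: le_trans (abel N.+1) _; rewrite tN Phi1 ?mulr1//; lra.
have SF : S (F n) @[n --> U] --> S Phi.
  rewrite /S; apply: cvg_big; first exact: add_continuous.
  by move=> i _; apply: cvgM; [exact: cvg_cst|exact: cvgB].
have lS : `|l - S Phi| <= L * h.
  have Pl : \int[P n]_x f x @[n --> U] --> l by apply: cvg_trans Pfl; exact: cvg_app.
  apply: (cvgr_to_le (cvg_norm (cvgB Pl SF))).
  apply: filterE => n; apply: RS; first exact: PF.
  + by apply: F0; rewrite /a; lra.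
  + by apply: F1; lra.
have QS : `|\int[Q]_x f x - S G| <= L * h.
  by apply: RS => //; [rewrite /G (right_reg0 ndPhi Phi0)// /a|rewrite /G (right_reg1 ndPhi Phi0 Phi1)//]; lra.
have -> : 3 * L * h = L * h + L * h + L * h by ring.
move: lS QS SG; rewrite !ler_norml => /andP[? ?] /andP[? ?] /andP[? ?].
by apply/andP; split; lra.
Qed.

End helly.

(** * Cauchy kernels *)

Section complex_inverse.
Context {R : realType}.
Local Open Scope complex_scope.
Implicit Types (z w : R[i]).

Lemma Re_invc z : complex.Re z^-1 =
  complex.Re z / (complex.Re z ^+ 2 + complex.Im z ^+ 2).
Proof. by case: z. Qed.

Lemma Im_invc z : complex.Im z^-1 =
  - (complex.Im z / (complex.Re z ^+ 2 + complex.Im z ^+ 2)).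
Proof. by case: z. Qed.

Lemma ReB z w : complex.Re (z - w) = complex.Re z - complex.Re w.
Proof. by case: z; case: w. Qed.

Lemma ImB z w : complex.Im (z - w) = complex.Im z - complex.Im w.
Proof. by case: z; case: w. Qed.

Lemma ReD z w : complex.Re (z + w) = complex.Re z + complex.Re w.
Proof. by case: z; case: w. Qed.

Lemma ImD z w : complex.Im (z + w) = complex.Im z + complex.Im w.
Proof. by case: z; case: w. Qed.

Lemma Re_sum (I : Type) (s : seq I) (P : pred I) (F : I -> R[i]) :
  complex.Re (\sum_(i <- s | P i) F i) = \sum_(i <- s | P i) complex.Re (F i).
Proof. by apply: (big_morph _ ReD). Qed.

Lemma Im_sum (I : Type) (s : seq I) (P : pred I) (F : I -> R[i]) :
  complex.Im (\sum_(i <- s | P i) F i) = \sum_(i <- s | P i) complex.Im (F i).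
Proof. by apply: (big_morph _ ImD). Qed.

Lemma ReZ (a : R) z : complex.Re (a%:C * z) = a * complex.Re z.
Proof. by case: z => x y /=; rewrite mul0r subr0. Qed.

Lemma ImZ (a : R) z : complex.Im (a%:C * z) = a * complex.Im z.
Proof. by case: z => x y /=; rewrite mul0r addr0. Qed.

Lemma complex_eqP z w : complex.Re z = complex.Re w ->
  complex.Im z = complex.Im w -> z = w.
Proof. by case: z; case: w => a b c d /= -> ->. Qed.

Lemma sqr_normc_gt0 z : z != 0 -> 0 < complex.Re z ^+ 2 + complex.Im z ^+ 2.
Proof.
case: z => x y; rewrite eq_complex/= negb_and => h.
rewrite lt_neqAle addr_ge0 ?sqr_ge0// andbT eq_sym paddr_eq0 ?sqr_ge0//.
by rewrite !sqrf_eq0 negb_and.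
Qed.

(** Convergence in R[i] is expressed through real and imaginary parts, because
integrals of complex functions are taken part by part. *)
Lemma cvg_invc (T : Type) (F : set_system T) (FF : Filter F) (u : T -> R[i]) z :
  z != 0 ->
  complex.Re (u n) @[n --> F] --> complex.Re z ->
  complex.Im (u n) @[n --> F] --> complex.Im z ->
  complex.Re (u n)^-1 @[n --> F] --> complex.Re z^-1 /\
  complex.Im (u n)^-1 @[n --> F] --> complex.Im z^-1.
Proof.
move=> z0 uR uI.
have uN : complex.Re (u n) ^+ 2 + complex.Im (u n) ^+ 2 @[n --> F] -->
    complex.Re z ^+ 2 + complex.Im z ^+ 2.
  by under eq_fun do rewrite !expr2; rewrite !expr2; apply: cvgD; exact: cvgM.
have z0' := sqr_normc_gt0 z0.
split.
  rewrite Re_invc; under eq_fun do rewrite Re_invc.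
  by apply: cvgM => //; apply: cvgV => //; rewrite gt_eqF.
rewrite Im_invc; under eq_fun do rewrite Im_invc.
by apply: cvgN; apply: cvgM => //; apply: cvgV => //; rewrite gt_eqF.
Qed.

End complex_inverse.

Section cauchy_kernel.
Context {R : realType}.
Local Open Scope complex_scope.
Variable z : R[i].
Hypothesis z0 : 0 < complex.Im z.
Let v := complex.Im z.

Lemma cauchy_kernel_Re (x : R) : complex.Re (z - x%:C)^-1 =
  (complex.Re z - x) / ((complex.Re z - x) ^+ 2 + v ^+ 2).
Proof. by rewrite Re_invc ReB ImB/= subr0. Qed.

Lemma cauchy_kernel_Im (x : R) : complex.Im (z - x%:C)^-1 =
  - (v / ((complex.Re z - x) ^+ 2 + v ^+ 2)).
Proof. by rewrite Im_invc ReB ImB/= subr0. Qed.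

Let den_gt0 (u : R) : 0 < u ^+ 2 + v ^+ 2.
Proof. by rewrite ltr_wpDl ?sqr_ge0// exprn_gt0. Qed.

Lemma cauchy_kernel_Im_le0 (x : R) : complex.Im (z - x%:C)^-1 <= 0.
Proof. by rewrite cauchy_kernel_Im oppr_le0 divr_ge0// ltW. Qed.

Let bound (a u : R) : a ^+ 2 <= u ^+ 2 + v ^+ 2 -> `|a / (u ^+ 2 + v ^+ 2)| <= v^-1.
Proof.
move=> h; have D := den_gt0 u.
rewrite normrM normfV (gtr0_norm D) ler_pdivrMr// mulrC ler_pdivlMr//.
rewrite -(@ler_pXn2r _ 2)// ?nnegrE ?mulr_ge0// ?(ltW z0)// ?(ltW D)//.
rewrite exprMn real_normK ?num_real//.
have : v ^+ 2 <= u ^+ 2 + v ^+ 2 by rewrite lerDr sqr_ge0.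
move=> h'; rewrite [leRHS]expr2; apply: ler_pM => //; exact: sqr_ge0.
Qed.

Lemma cauchy_kernel_Re_bound x : `|complex.Re (z - x%:C)^-1| <= v^-1.
Proof. by rewrite cauchy_kernel_Re bound// lerDl sqr_ge0. Qed.

Lemma cauchy_kernel_Im_bound x : `|complex.Im (z - x%:C)^-1| <= v^-1.
Proof. by rewrite cauchy_kernel_Im normrN bound// lerDr sqr_ge0. Qed.

(** Both numerators of interest, v^2 - u u' and v (u + u'), satisfy the hypothesis:
the sum of their squares is (u^2 + v^2) (u'^2 + v^2). *)
Let lip (a u u' : R) :
  a ^+ 2 <= (u ^+ 2 + v ^+ 2) * (u' ^+ 2 + v ^+ 2) ->
  `|a / ((u ^+ 2 + v ^+ 2) * (u' ^+ 2 + v ^+ 2))| <= v ^- 2.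
Proof.
move=> h; have D := mulr_gt0 (den_gt0 u) (den_gt0 u').
have v20 : 0 < v ^+ 2 by rewrite exprn_gt0.
set S := _ * _ in h D *.
rewrite normrM normfV (gtr0_norm D) ler_pdivrMr// mulrC ler_pdivlMr//.
have P1 : 0 <= `|a| * v ^+ 2 by apply: mulr_ge0 => //; exact: ltW.
rewrite -(@ler_pXn2r _ 2)// ?nnegrE ?P1 ?(ltW D)//.
rewrite exprMn real_normK ?num_real// [leRHS]expr2; apply: ler_pM => //.
- exact: sqr_ge0.
- exact: sqr_ge0.
- by rewrite expr2 /S; apply: ler_pM; rewrite ?(ltW v20)// lerDr sqr_ge0.
Qed.

Lemma cauchy_kernel_Re_lipschitz x y :
  `|complex.Re (z - x%:C)^-1 - complex.Re (z - y%:C)^-1| <= v ^- 2 * `|x - y|.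
Proof.
rewrite !cauchy_kernel_Re; set u := _ - x; set u' := _ - y.
have := den_gt0 u; have := den_gt0 u' => D' D.
have -> : u / (u ^+ 2 + v ^+ 2) - u' / (u' ^+ 2 + v ^+ 2) =
  (v ^+ 2 - u * u') / ((u ^+ 2 + v ^+ 2) * (u' ^+ 2 + v ^+ 2)) * (u - u').
  by field; rewrite !gt_eqF.
rewrite normrM (_ : `|u - u'| = `|x - y|); last first.
  by rewrite distrC /u /u'; congr `|_|; ring.
rewrite ler_wpM2r// lip//.
have -> : (u ^+ 2 + v ^+ 2) * (u' ^+ 2 + v ^+ 2) =
  (v ^+ 2 - u * u') ^+ 2 + (v * (u + u')) ^+ 2 by ring.
by rewrite lerDl sqr_ge0.
Qed.

Lemma cauchy_kernel_Im_lipschitz x y :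
  `|complex.Im (z - x%:C)^-1 - complex.Im (z - y%:C)^-1| <= v ^- 2 * `|x - y|.
Proof.
rewrite !cauchy_kernel_Im; set u := _ - x; set u' := _ - y.
have := den_gt0 u; have := den_gt0 u' => D' D.
have -> : - (v / (u ^+ 2 + v ^+ 2)) - - (v / (u' ^+ 2 + v ^+ 2)) =
  (v * (u + u')) / ((u ^+ 2 + v ^+ 2) * (u' ^+ 2 + v ^+ 2)) * (u - u').
  by field; rewrite !gt_eqF.
rewrite normrM (_ : `|u - u'| = `|x - y|); last first.
  by rewrite distrC /u /u'; congr `|_|; ring.
rewrite ler_wpM2r// lip//.
have -> : (u ^+ 2 + v ^+ 2) * (u' ^+ 2 + v ^+ 2) =
  (v ^+ 2 - u * u') ^+ 2 + (v * (u + u')) ^+ 2 by ring.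
by rewrite lerDr sqr_ge0.
Qed.

End cauchy_kernel.

Lemma lipschitz_continuous {R : realType} (f : R -> R) (L : R) :
  (forall x y, `|f x - f y| <= L * `|x - y|) -> continuous f.
Proof.
move=> fL x.
apply/cvgrPdist_lt => e e0.
have L0 : 0 <= L.
  by have := le_trans (normr_ge0 _) (fL 1 0); rewrite subr0 normr1 mulr1.
have d0 : 0 < e / (L + 1) by rewrite divr_gt0//; lra.
near=> y.
rewrite (le_lt_trans (fL _ _))//.
rewrite (@le_lt_trans _ _ ((L + 1) * `|x - y|))//.
  by rewrite ler_wpM2r//; lra.
rewrite mulrC -ltr_pdivlMr; last by lra.
by near: y; move: d0; apply: cvgr_dist_lt; exact: cvg_id.
Unshelve. all: by end_near. Qed.

Lemma lipschitz_measurable {R : realType} (f : R -> R) (L : R) :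
  (forall x y, `|f x - f y| <= L * `|x - y|) ->
  measurable_fun (setT : set (measurableTypeR R)) f.
Proof. by move=> fL; apply: continuous_measurable_fun; exact: lipschitz_continuous fL. Qed.

(** * Finite Nevanlinna representations *)

Section atomic.
Context {R : realType} {N : nat}.
Local Notation RT := (measurableTypeR R).
Variables (w d : 'I_N.+1 -> R).
Hypotheses (w0 : forall k, 0 <= w k) (w1 : \sum_k w k = 1).

Definition atomic : set RT -> \bar R :=
  msum (fun n => mscale (NngNum (w0 (inord n))) (\d_(d (inord n) : RT))) N.+1.

HB.instance Definition _ := Measure.on atomic.

Let atomicE (A : set RT) : atomic A = (\sum_k (w k)%:E * (\1_A (d k))%:E)%E.
Proof. by apply: eq_bigr => k _; rewrite /mscale/= inord_val. Qed.

Lemma atomic1 (A : set RT) : (forall k, A (d k)) -> atomic A = 1%E.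
Proof.
move=> Ad; rewrite atomicE -w1 -sumEFin; apply: eq_bigr => k _.
by rewrite indicE mem_set// mule1.
Qed.

HB.instance Definition _ := @Measure_isProbability.Build _ _ R atomic
  (@atomic1 setT (fun=> I)).

Lemma Rintegral_atomic (f : R -> R) (B : R) :
  measurable_fun (setT : set RT) f -> (forall x, `|f x| <= B) ->
  \int[atomic]_x f x = \sum_k w k * f (d k).
Proof.
move=> mf fB.
have fB0 x : 0 <= f x + B by have := fB x; rewrite ler_norml => /andP[? _]; lra.
have mfB : measurable_fun (setT : set RT) (fun x => (f x + B)%:E).
  by apply/measurable_EFinP; exact: measurable_funD.
have intE : (\int[atomic]_x (f x + B)%:E = (\sum_k w k * (f (d k) + B))%:E)%E.
  rewrite ge0_integral_measure_sum//; last by move=> x _; rewrite lee_fin.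
  rewrite -sumEFin; apply: eq_bigr => k _.
  rewrite ge0_integral_mscale//; last by move=> x _; rewrite lee_fin.
  by rewrite integral_dirac//= diracT mul1e inord_val.
have ic (c : R) : atomic.-integrable setT (EFin \o cst c).
  exact: finite_measure_integrable_cst.
have fE : f = (fun x => (f x + B) - cst B x) by apply/funext => x; rewrite addrK.
have ifB : atomic.-integrable setT (EFin \o (fun x => f x + B)).
  apply/integrableP; split => //=.
  rewrite (@eq_integral _ RT R _ _ (fun x => (f x + B)%:E)) ?intE ?ltry// => x _.
  by rewrite /= ger0_norm.
rewrite [in LHS]fE RintegralB// [X in X - _]/Rintegral intE/= Rintegral_cst//.
rewrite (_ : fine _ = 1) ?mulr1; last by have /(congr1 fine) := @atomic1 setT (fun=> I).
under eq_bigr do rewrite mulrDr.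
by rewrite big_split/= -mulr_suml w1 mul1r addrK.
Qed.

(** Existential form, because the probability structure of [atomic] depends on the
proof that the weights sum to 1. *)
Lemma atomic_probability : exists nu : probability RT R,
  (forall A : set RT, (forall k, A (d k)) -> nu A = 1%E) /\
  (forall (f : R -> R) (B : R),
    measurable_fun (setT : set RT) f -> (forall x, `|f x| <= B) ->
    \int[nu]_x f x = \sum_k w k * f (d k)).
Proof. by exists atomic; split; [exact: atomic1|exact: Rintegral_atomic]. Qed.

End atomic.


Section arrow_probability.
Context {R : realType}.
Local Notation RT := (measurableTypeR R).
Local Notation leb := (@lebesgue_measure R).
Local Open Scope complex_scope.

(** The measure is the spectral measure, at the first basis vector, of the arrow
matrix with border sqrt (s j). An eigenvalue d with K <= |d| would be at
distance at least 1 from every x j, and the secular equation would give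
|d| <= sum_j s j < K. *)
Lemma arrow_probability (N : nat) (s x : 'I_N -> R) (M : R) :
  0 <= M -> (forall j, 0 <= s j) -> (forall j, `|x j| <= M) ->
  let K := M + \sum_j s j + 2 in
  exists nu : probability RT R, nu `]- K, K]%classic = 1%E /\
    forall z : R[i], 0 < complex.Im z ->
      cauchy_transform nu z = (z - \sum_j (s j)%:C / (z - (x j)%:C))^-1.
Proof.
move=> M0 s0 xM K.
have realC (a : R) : (a%:C : R[i]) \is Num.real by apply/complex_realP; exists a.
have [w [d [w0 w1 dR dE GE]]] := @arrow_mx_spectral R[i] N
  (fun j => (Num.sqrt (s j))%:C) (fun j => (x j)%:C)
  (fun j => realC _) (fun j => realC _).
have wE k : w k = (complex.Re (w k))%:C.
  by rewrite RRe_real// ger0_real.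
have dE' k : d k = (complex.Re (d k))%:C by rewrite RRe_real.
pose w' k := complex.Re (w k); pose d' k := complex.Re (d k).
have sE j : (Num.sqrt (s j))%:C ^+ 2 = (s j)%:C :> R[i].
  by rewrite -rmorphXn/= sqr_sqrtr.
have w'0 k : 0 <= w' k by have := w0 k; rewrite wE ler0c.
have w'1 : \sum_k w' k = 1.
  have /(congr1 (@complex.Re R)) := w1.
  by rewrite Re_sum.
have s_ge0 : 0 <= \sum_j s j by apply: sumr_ge0.
have d'K k : `|d' k| < K.
  rewrite ltNge; apply/negP => Kd.
  have xd j : 1 + \sum_j s j <= `|d' k - x j|.
    have := lerB_dist (d' k) (x j); have := xM j; rewrite /K in Kd.
    by lra.
  have dx j : d k != (x j)%:C.
    rewrite dE' (inj_eq (@complexI R)) -subr_eq0 -normr_gt0.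
    by have := xd j; rewrite -/(d' k); lra.
  have := dE k dx.
  rewrite dE'; under eq_bigr do rewrite sE -rmorphB/= -fmorphV -rmorphM/=.
  rewrite -rmorph_sum => /complexI; rewrite -/(d' k) => d'E.
  have : `|d' k| <= \sum_j s j.
    rewrite {1}d'E (le_trans (ler_norm_sum _ _ _))//.
    apply: ler_sum => j _; rewrite normrM (ger0_norm (s0 j)) ler_piMr//.
    by rewrite normfV invf_le1; have := xd j; lra.
  have sK : \sum_j s j < K by rewrite /K; lra.
  by lra.
have [nu [nu1 intnu]] := atomic_probability d' w'0 w'1.
exists nu; split.
  apply: nu1 => k /=; rewrite in_itv/=.
  by have := d'K k; rewrite ltr_norml => /andP[-> /ltW].
move=> z z0; under [in RHS]eq_bigr do rewrite -sE.
rewrite -GE; last first.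
  by apply/complex_realP => -[a za]; move: z0; rewrite za/= ltxx.
rewrite /cauchy_transform /Cintegral.
apply: complex_eqP => /=.
  rewrite (intnu _ _ (lipschitz_measurable (cauchy_kernel_Re_lipschitz z0))
    (cauchy_kernel_Re_bound z0)) Re_sum.
  by apply: eq_bigr => k _; rewrite wE dE' ReZ.
rewrite (intnu _ _ (lipschitz_measurable (cauchy_kernel_Im_lipschitz z0))
    (cauchy_kernel_Im_bound z0)) Im_sum.
by apply: eq_bigr => k _; rewrite wE dE' ImZ.
Qed.
End arrow_probability.

(** * Nevanlinna representations with a density *)

Section nevanlinna.
Context {R : realType}.
Local Notation RT := (measurableTypeR R).
Local Notation leb := (@lebesgue_measure R).
Local Open Scope complex_scope.

(** The Cauchy transform of the measure g(x) dx, whose total mass is arbitrary. *)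
Definition density_transform (g : R -> R) (z : R[i]) : R[i] :=
  (\int[leb]_x (complex.Re (z - x%:C)^-1 * g x)) +i*
  (\int[leb]_x (complex.Im (z - x%:C)^-1 * g x)).

Lemma density_transform_Im_le0 g z : (forall x, 0 <= g x) -> 0 < complex.Im z ->
  complex.Im (density_transform g z) <= 0.
Proof.
move=> g0 z0; apply: fine_le0.
have h0 x : (0 <= (- complex.Im (z - x%:C)^-1 * g x)%:E)%E.
  by rewrite lee_fin mulr_ge0// oppr_ge0 cauchy_kernel_Im_le0.
under eq_integral do rewrite -[X in X * _]opprK mulNr EFinN.
rewrite integral_ge0N => [|x _]; last exact: h0.
by rewrite oppe_le0; apply: integral_ge0 => x _; exact: h0.
Qed.

(** Moving the mass of g on each cell to the right end of the cell approximates the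
measure g(x) dx by finitely many atoms. *)
Lemma riemann_sum_cvg (g f : R -> R) (M B L : R) : 0 < M ->
  (forall x, 0 <= g x) -> leb.-integrable setT (EFin \o g) ->
  (forall x : R, x \notin `]- M, M] -> g x = 0) ->
  (forall x, `|f x| <= B) -> (forall x y, `|f x - f y| <= L * `|x - y|) ->
  let t n i := - M + i%:R * (2 * M / n.+1%:R) in
  \sum_(0 <= i < n.+1) f (t n i.+1) * (\int[leb]_(x in `]t n i, t n i.+1]) g x)
    @[n --> \oo] --> \int[leb]_x (f x * g x).
Proof.
move=> M0 g0 ig gM fB fL t.
set m := \int[leb]_(x in `]- M, M]) g x.
have m0 : 0 <= m by apply: Rintegral_ge0.
have -> : \int[leb]_x (f x * g x) = \int[leb]_(x in `]- M, M]) (f x * g x).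
  rewrite [RHS]Rintegral_mkcond; apply: eq_Rintegral => x _.
  rewrite patchE; case: ifPn => //; rewrite notin_setE => /negP xM.
  by rewrite gM ?mulr0.
have mf := lipschitz_measurable fL.
have tM n : t n n.+1 = M by rewrite /t mulrCA divff ?pnatr_eq0// mulr1; ring.
have h0 n : 0 <= 2 * M / n.+1%:R by rewrite divr_ge0 ?mulr_ge0 ?ltW.
have bound n := riemann_stieltjes_sum g0 ig mf fB fL (- M) (h0 n) n.+1.
have L0 : 0 <= L.
  by have := le_trans (normr_ge0 _) (fL 1 0); rewrite subr0 normr1 mulr1.
apply/cvgrPdist_le => e e0.
have lim0 : L * (2 * M / n.+1%:R) * m @[n --> \oo] --> L * (2 * M * 0) * m.
  apply: cvgM; last exact: cvg_cst.
  apply: cvgM; first exact: cvg_cst.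
  apply: cvgM; first exact: cvg_cst.
  exact: cvg_harmonic.
rewrite mulr0 mulr0 mul0r in lim0.
near=> n; have := bound n; rewrite -/(t n n.+1) tM => /le_trans; apply.
near: n; move/cvgrPdist_le : lim0 => /(_ e e0); apply: filterS => n.
by rewrite sub0r normrN ger0_norm// mulr_ge0// mulr_ge0.
Unshelve. all: by end_near. Qed.

(** The atomic approximations of g(x) dx keep the same total mass and the same
bounded support, so the probability measures that [arrow_probability] attaches to
them live on one interval. Their Cauchy transforms (z - S n)^-1 converge to
(z - G)^-1, where z - G has a positive imaginary part, and any limit measure given
by [helly] has this Cauchy transform. *)
Theorem nevanlinna_compact_support (g : R -> R) (M : R) :
  (forall x, 0 <= g x) -> leb.-integrable setT (EFin \o g) ->
  (forall x : R, x \notin `]- M, M] -> g x = 0) ->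
  exists nu : probability RT R, forall z : R[i], 0 < complex.Im z ->
    F_transform nu z = z - density_transform g z.
Proof.
wlog M0 : M / 0 < M => [hwlog g0 ig gM|].
  (* A larger interval still contains the support of g. *)
  have M1 : 0 < `|M| + 1 by rewrite ltr_wpDl.
  apply: (hwlog _ M1) => // x xM; apply: gM; apply: contra xM.
  rewrite !in_itv/= => /andP[Mx xM].
  have := ler_norm M; have := ler_norm (- M); rewrite normrN => ? ?.
  by apply/andP; split; lra.
move=> g0 ig gM.
pose t n i : R := - M + i%:R * (2 * M / n.+1%:R).
pose s n (i : nat) := \int[leb]_(x in `]t n i, t n i.+1]) g x.
pose m := \int[leb]_(x in `]- M, M]) g x.
have s0 n i : 0 <= s n i by apply: Rintegral_ge0.
have h0 n : 0 <= 2 * M / n.+1%:R by rewrite divr_ge0 ?mulr_ge0 ?ltW.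
have tM n : t n n.+1 = M by rewrite /t mulrCA divff ?pnatr_eq0// mulr1; ring.
have ts n (i : 'I_n.+1) : `|t n i.+1| <= M.
  rewrite ler_norml lerDl mulr_ge0//= -[leRHS](tM n) lerD2l ler_wpM2r// ler_nat.
  exact: ltn_ord.
have sm n : \sum_(i < n.+1) s n i = m.
  have := @riemann_stieltjes_sum R leb (cst 1) g 1 0 g0 ig (measurable_cst _)
    (fun=> _) (fun _ _ => _) (- M) _ (h0 n) n.+1.
  rewrite -/(t n n.+1) tM !mul0r normr_le0 subr_eq0 big_mkord => /(_ _ _)/eqP h.
  rewrite [LHS](eq_bigr (fun i : 'I_n.+1 => 1 * s n i)); last first.
    by move=> i _; rewrite mul1r.
  rewrite -h.
  - by apply: eq_Rintegral => x _; rewrite mul1r.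
  - by move=> x; rewrite normr1.
  - by move=> x y; rewrite subrr normr0 mul0r.
have := fun n => arrow_probability (ltW M0) (fun i : 'I_n.+1 => s0 n i) (@ts n).
move=> /= /choice[P]; set K := M + m + 2 => PE.
have [|nu nuE] := @helly R K P.
  by move=> n; have [+ _] := PE n; rewrite sm.
exists nu => z z0.
set G := density_transform g z.
have zG0 : z - G != 0.
  apply/eqP => /(congr1 (@complex.Im R)); rewrite ImB [RHS]/= => h.
  by have := density_transform_Im_le0 g0 z0; rewrite -/G; lra.
suff GE : cauchy_transform nu z = (z - G)^-1 by rewrite /F_transform GE invrK.
pose S n := \sum_(i < n.+1) (s n i)%:C / (z - (t n i.+1)%:C).
have SR : complex.Re (z - S n) @[n --> \oo] --> complex.Re (z - G).
  rewrite ReB; under eq_fun do rewrite ReB; apply: cvgB; first exact: cvg_cst.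
  have := @riemann_sum_cvg g _ M _ _ M0 g0 ig gM (cauchy_kernel_Re_bound z0)
    (cauchy_kernel_Re_lipschitz z0).
  apply: cvg_trans; apply: near_eq_cvg; apply: nearW => n.
  by rewrite Re_sum big_mkord; apply: eq_bigr => i _; rewrite ReZ mulrC.
have SI : complex.Im (z - S n) @[n --> \oo] --> complex.Im (z - G).
  rewrite ImB; under eq_fun do rewrite ImB; apply: cvgB; first exact: cvg_cst.
  have := @riemann_sum_cvg g _ M _ _ M0 g0 ig gM (cauchy_kernel_Im_bound z0)
    (cauchy_kernel_Im_lipschitz z0).
  apply: cvg_trans; apply: near_eq_cvg; apply: nearW => n.
  by rewrite Im_sum big_mkord; apply: eq_bigr => i _; rewrite ImZ mulrC.
have [cR cI] := cvg_invc _ zG0 SR SI.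
have PG n : cauchy_transform (P n) z = (z - S n)^-1 by have [_ ->] := PE n.
apply: complex_eqP.
  apply: (nuE _ _ _ _ (lipschitz_measurable (cauchy_kernel_Re_lipschitz z0))
    (cauchy_kernel_Re_bound z0) (cauchy_kernel_Re_lipschitz z0)).
  apply: cvg_trans cR; apply: near_eq_cvg; apply: nearW => n.
  by rewrite -PG.
apply: (nuE _ _ _ _ (lipschitz_measurable (cauchy_kernel_Im_lipschitz z0))
  (cauchy_kernel_Im_bound z0) (cauchy_kernel_Im_lipschitz z0)).
apply: cvg_trans cI; apply: near_eq_cvg; apply: nearW => n.
by rewrite -PG.
Qed.

End nevanlinna.

(** * The fundamental theorem of calculus on a symmetric open interval *)

Section symmetric_FTC.
Context {R : realType}.
Local Notation leb := (@lebesgue_measure R).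
Local Notation RT := (measurableTypeR R).

Lemma integrable_exhaustion (f : R -> R) (a : R) (u : nat -> R) :
  0 < a -> (forall n, 0 < u n < a) -> u n @[n --> \oo] --> a ->
  leb.-integrable (`]- a, a[ : set RT) (EFin \o f) ->
  \int[leb]_(x in `[- u n, u n]) f x @[n --> \oo] --> \int[leb]_(x in `]- a, a[) f x.
Proof.
move=> a0 ua ucvg intf.
apply: fine_cvg.
rewrite -[X in _ --> X]/((\int[leb]_(x in `]- a, a[) f x)%:E).
rewrite [X in _ --> X](_ : _ = (\int[leb]_(x in `](- a)%R, a[) (f x)%:E)%E); last first.
  by rewrite fineK//; exact: integrable_fin_num.
have sub n : `[- u n, u n]%classic `<=` `]- a, a[%classic.
  move=> x /=; rewrite !in_itv/= => /andP[x1 x2]; have /andP[_ un] := ua n.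
  by apply/andP; split; lra.
have -> : (fun n => (\int[leb]_(x in `[(- u n)%R, u n]) (f x)%:E)%E) =
    (fun n => (\int[leb]_(x in `](- a)%R, a[)
      ((EFin \o f) \_ `[(- u n)%R, u n]) x)%E).
  by apply/funext => n; rewrite -integral_mkcondr setIidr.
have mf := measurable_int _ intf.
apply: (@dominated_cvg _ RT R leb _ _ _ _ (fun x => `|f x|%:E)) => //.
- move=> n; apply/measurable_restrict => //; apply: measurable_funS mf => //.
- move=> x /= xa; apply: cvg_near_cst.
  have xa' : 0 < a - `|x|.
    by move: xa; rewrite in_itv/= subr_gt0 ltr_norml.
  move/cvgrPdist_lt : ucvg => /(_ _ xa'); apply: filterS => n /=.
  rewrite ltr_norml => /andP[_ h]; rewrite patchE mem_set//=.
  by rewrite in_itv/= -ler_norml; lra.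
- exact: (integrable_norm intf).
- move=> n x _; rewrite patchE; case: ifPn => // _.
  by rewrite abse0 lee_fin.
Qed.

(** Only the even part of f counts on symmetric intervals, hence a primitive of the
even part suffices. For the product of 1 / (z - x) and an even weight, the even
part is z / (z^2 - x^2) times the weight, and its primitive is explicit. *)
Lemma symmetric_FTC (f Phi : R -> R) (a l : R) (u : nat -> R) :
  0 < a -> (forall n, 0 < u n < a) -> u n @[n --> \oo] --> a ->
  leb.-integrable (`]- a, a[ : set RT) (EFin \o f) ->
  (forall x, x \in `]- a, a[ -> {for x, continuous f}) ->
  (forall x, x \in `]- a, a[ -> is_derive x 1 Phi ((f x + f (- x)) / 2)) ->
  Phi (u n) - Phi (- u n) @[n --> \oo] --> l ->
  \int[leb]_(x in `]- a, a[) f x = l.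
Proof.
move=> a0 ua ucvg intf cf dPhi Phil.
apply/esym/(cvg_unique _ Phil); first exact: norm_hausdorff.
have := integrable_exhaustion a0 ua ucvg intf; apply: cvg_trans.
apply: near_eq_cvg; apply: nearW => n.
have /andP[un0 una] := ua n.
have sub x : x \in `[- u n, u n] -> x \in `]- a, a[.
  by rewrite !in_itv/= => /andP[x1 x2]; apply/andP; split; lra.
have opp x : x \in `]- a, a[ -> - x \in `]- a, a[.
  by rewrite !in_itv/= => /andP[x1 x2]; apply/andP; split; lra.
have cfN x : x \in `]- a, a[ -> {for x, continuous (f \o -%R)}.
  move=> /opp xa; apply: continuous_comp; first exact: opp_continuous.
  exact: cf.
have mI : measurable (`[- u n, u n]%classic : set RT) by [].
have intI : leb.-integrable (`[- u n, u n]%classic : set RT) (EFin \o f).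
  apply: integrableS intf => //; exact: sub.
have cfI : {within `[- u n, u n], continuous f}.
  by apply: continuous_in_subspaceT => x; rewrite inE => /sub /cf.
have cfNI : {within `[- u n, u n], continuous (f \o -%R)}.
  by apply: continuous_in_subspaceT => x; rewrite inE => /sub /cfN.
have intNI : leb.-integrable (`[- u n, u n]%classic : set RT) (EFin \o (f \o -%R)).
  exact: (continuous_compact_integrable (@segment_compact _ _ _) cfNI).
have E1 : \int[leb]_(x in `[- u n, u n]) f x = \int[leb]_(x in `[- u n, u n]) f (- x).
  congr fine; have := @integration_by_substitution_oppr R f (- u n) (u n).
  by rewrite opprK; apply => //; lra.
have E2 : \int[leb]_(x in `[- u n, u n]) ((f x + f (- x)) / 2) =
    \int[leb]_(x in `[- u n, u n]) f x.
  rewrite RintegralZr//; last first.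
    by have := integrableD mI intI intNI; apply: eq_integrable.
  rewrite RintegralD// -[X in _ + X]E1.
  by rewrite -mulr2n -[X in X / 2]mulr_natr mulfK.
rewrite -E2 /Rintegral (@continuous_FTC2 _ _ Phi)//.
- lra.
- apply: continuous_in_subspaceT => x; rewrite inE => /sub xa.
  apply: cvgM; last exact: cvg_cst.
  by apply: cvgD; [exact: cf|exact: cfN].
- have cPhi x : x \in `]- a, a[ -> {for x, continuous Phi}.
    move=> /dPhi[dP _].
    exact/differentiable_continuous/derivable1_diffP.
  split.
  + by move=> x /subset_itv_oo_cc /sub/dPhi[].
  + apply: cvg_at_right_filter; apply: cPhi; apply: sub; rewrite in_itv/= lexx; lra.
  + apply: cvg_at_left_filter; apply: cPhi; apply: sub; rewrite in_itv/= lexx andbT; lra.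
- move=> x /subset_itv_oo_cc /sub/dPhi dP.
  by rewrite derive1E derive_val.
Qed.

End symmetric_FTC.

(** * Cauchy transform of the arcsine density *)

(** Outside ]-a, a[ the square root is 0, hence so is the inverse: the density is cut
off without an indicator function. *)
Definition arcsine {R : realType} (a x : R) : R :=
  (pi * Num.sqrt (a ^+ 2 - x ^+ 2))^-1.

Lemma arcsine_eq0 {R : realType} (a x : R) : a ^+ 2 <= x ^+ 2 -> arcsine a x = 0.
Proof. by move=> ax; rewrite /arcsine ler0_sqrtr ?subr_le0// mulr0 invr0. Qed.

Lemma arcsineN {R : realType} (a x : R) : arcsine a (- x) = arcsine a x.
Proof. by rewrite /arcsine sqrrN. Qed.

Section arcsine_substitution.
Context {R : realType}.
Variable a : R.
Hypothesis a0 : 0 < a.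

Lemma itv_sqr_lt (x : R) : (x \in `]- a, a[) = (x ^+ 2 < a ^+ 2).
Proof.
rewrite in_itv/= -ltr_norml -(real_normK (num_real x)).
by rewrite ltr_sqr ?nnegrE ?normr_ge0 ?ltW.
Qed.

Lemma continuous_arcsine (x : R) : x \in `]- a, a[ -> {for x, continuous (arcsine a)}.
Proof.
rewrite itv_sqr_lt => xa.
apply: cvgV; first by rewrite gt_eqF// mulr_gt0 ?pi_gt0 ?sqrtr_gt0 ?subr_gt0.
apply: cvgM; first exact: cvg_cst.
apply: continuous_comp; last exact: sqrt_continuous.
by apply: cvgB; [exact: cvg_cst|exact: exprn_continuous].
Qed.

(** tan (arcsin (x / a)); for this variable t, dx / sqrt (a^2 - x^2) = dt / (1 + t^2). *)
Definition tanarcsin (x : R) : R := x / Num.sqrt (a ^+ 2 - x ^+ 2).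

Lemma is_derive_tanarcsin (x : R) : x \in `]- a, a[ ->
  is_derive x 1 tanarcsin (a ^+ 2 / Num.sqrt (a ^+ 2 - x ^+ 2) ^+ 3).
Proof.
rewrite itv_sqr_lt => xa.
set q := Num.sqrt (a ^+ 2 - x ^+ 2).
have q0 : 0 < q by rewrite sqrtr_gt0 subr_gt0.
have q2 : q ^+ 2 = a ^+ 2 - x ^+ 2 by rewrite sqr_sqrtr// subr_ge0 ltW.
have dq : is_derive x 1 (fun x : R => a ^+ 2 - x ^+ 2) (- (2 * x)).
  apply: is_derive_eq; rewrite /GRing.scale/=; ring.
have dw : is_derive x 1 (Num.sqrt \o (fun x : R => a ^+ 2 - x ^+ 2))
    ((2 * q)^-1 * - (2 * x)).
  by apply: (is_derive1_comp _ dq); apply: is_derive1_sqrt; rewrite subr_gt0.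
have dV : is_derive x 1 (fun x : R => (Num.sqrt (a ^+ 2 - x ^+ 2))^-1)
    (- q ^- 2 *: ((2 * q)^-1 * - (2 * x))).
  by apply: is_deriveV => //; rewrite gt_eqF.
apply: (is_derive_eq (is_deriveM (is_derive_id x 1) dV)).
rewrite /GRing.scale/= -/q.
have -> : a ^+ 2 = q ^+ 2 + x ^+ 2 by rewrite q2; ring.
by field; rewrite gt_eqF.
Qed.

(** a * sin (arctan (n + 1)), a sequence increasing to a on which [tanarcsin] takes
integer values. *)
Definition sinarctan (n : nat) : R := a * n.+1%:R / Num.sqrt (1 + n.+1%:R ^+ 2).

Let den_gt0 n : 0 < 1 + n.+1%:R ^+ 2 :> R.
Proof. by rewrite addr_gt0. Qed.

Let sinarctan2 n : sinarctan n ^+ 2 = a ^+ 2 * n.+1%:R ^+ 2 / (1 + n.+1%:R ^+ 2).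
Proof. by rewrite expr_div_n exprMn (sqr_sqrtr (ltW (den_gt0 n))). Qed.

Lemma sinarctan_itv n : 0 < sinarctan n < a.
Proof.
have s0 : 0 < sinarctan n by rewrite divr_gt0 ?mulr_gt0 ?sqrtr_gt0.
rewrite s0/= -ltr_sqr ?nnegrE ?(ltW a0) ?(ltW s0)// sinarctan2.
rewrite ltr_pdivrMr// ltr_pM2l ?exprn_gt0//; lra.
Qed.

Lemma sinarctanK n : tanarcsin (sinarctan n) = n.+1%:R.
Proof.
rewrite /tanarcsin.
have -> : a ^+ 2 - sinarctan n ^+ 2 = (a / Num.sqrt (1 + n.+1%:R ^+ 2)) ^+ 2.
  rewrite sinarctan2 expr_div_n (sqr_sqrtr (ltW (den_gt0 n))).
  by field; rewrite gt_eqF.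
have s0 : 0 < Num.sqrt (1 + n.+1%:R ^+ 2 : R) by rewrite sqrtr_gt0.
rewrite sqrtr_sqr ger0_norm; last by rewrite divr_ge0 ?ltW.
rewrite /sinarctan; move: (Num.sqrt _) s0 => s s0.
by field; rewrite !gt_eqF.
Qed.

Lemma tanarcsinN x : tanarcsin (- x) = - tanarcsin x.
Proof. by rewrite /tanarcsin sqrrN mulNr. Qed.

Lemma cvg_sinarctan : sinarctan n @[n --> \oo] --> a.
Proof.
have h0 := @cvg_harmonic R.
have lim : a / Num.sqrt (harmonic n ^+ 2 + 1) @[n --> \oo] --> a / Num.sqrt (0 ^+ 2 + 1).
  apply: cvgM; first exact: cvg_cst.
  apply: cvgV; first by rewrite expr0n/= add0r sqrtr1 oner_eq0.
  apply: (@cvg_comp _ _ _ (fun n => harmonic n ^+ 2 + 1) Num.sqrt _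
    (nbhs (0 ^+ 2 + 1 : R))); last exact: sqrt_continuous.
  apply: cvgD; last exact: cvg_cst.
  exact: (cvg_comp _ _ h0 (@exprn_continuous R 2 0)).
rewrite expr0n/= add0r sqrtr1 divr1 in lim.
apply: cvg_trans lim; apply: near_eq_cvg; apply: nearW => n.
rewrite /sinarctan /harmonic/=.
have -> : n.+1%:R^-1 ^+ 2 + 1 = (1 + n.+1%:R ^+ 2) / n.+1%:R ^+ 2 :> R.
  have := ltr0Sn R n; move: (n.+1%:R : R) => N N0.
  by field; rewrite gt_eqF.
rewrite sqrtrM ?(ltW (den_gt0 n))// sqrtrV ?exprn_ge0// sqrtr_sqr ger0_norm//.
have s0 : 0 < Num.sqrt (1 + n.+1%:R ^+ 2 : R) by rewrite sqrtr_gt0.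
have := ltr0Sn R n; move: (n.+1%:R : R) s0 => N + N0; move: (Num.sqrt _) => s s0.
by field; rewrite !gt_eqF.
Qed.

End arcsine_substitution.

Section resolvent_primitive.
Context {R : realType}.
Variables b1 b2 : R.
Hypothesis b20 : 0 < b2.

(** Up to an imaginary constant, [prim_Re] + i [prim_Im] is
log (t - beta) - log (t + beta) with beta = b1 + i b2, the primitive of
1 / (t - beta) - 1 / (t + beta). *)
Definition prim_Re (t : R) : R :=
  2^-1 * (ln ((t - b1) ^+ 2 + b2 ^+ 2) - ln ((t + b1) ^+ 2 + b2 ^+ 2)).
Definition prim_Im (t : R) : R := atan ((t - b1) / b2) + atan ((t + b1) / b2).

Let den_gt0 (u : R) : 0 < u ^+ 2 + b2 ^+ 2.
Proof. by rewrite ltr_wpDl ?sqr_ge0// exprn_gt0. Qed.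

Lemma prim_ReN t : prim_Re (- t) = - prim_Re t.
Proof.
rewrite /prim_Re -opprD sqrrN (_ : - t + b1 = - (t - b1)); last by ring.
by rewrite sqrrN; ring.
Qed.

Lemma prim_ImN t : prim_Im (- t) = - prim_Im t.
Proof.
rewrite /prim_Im -opprD mulNr atanN (_ : - t + b1 = - (t - b1)); last by ring.
by rewrite mulNr atanN; ring.
Qed.

Lemma is_derive_prim_Re (t : R) : is_derive t 1 prim_Re
  ((t - b1) / ((t - b1) ^+ 2 + b2 ^+ 2) - (t + b1) / ((t + b1) ^+ 2 + b2 ^+ 2)).
Proof.
have d1 (e : R) : is_derive t 1 (@ln R \o (fun t => (t + e) ^+ 2 + b2 ^+ 2))
    (((t + e) ^+ 2 + b2 ^+ 2)^-1 * (2 * (t + e))).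
  have dq : is_derive t 1 (fun t : R => (t + e) ^+ 2 + b2 ^+ 2) (2 * (t + e)).
    by apply: is_derive_eq; rewrite /GRing.scale/=; ring.
  by apply: (is_derive1_comp _ dq); exact: is_derive1_ln.
have d2 : is_derive t 1 (@ln R \o (fun t => (t - b1) ^+ 2 + b2 ^+ 2))
    (((t - b1) ^+ 2 + b2 ^+ 2)^-1 * (2 * (t - b1))) by exact: (d1 (- b1)).
have d3 := is_deriveZ 2^-1 (is_deriveB d2 (d1 b1)).
apply: (is_derive_eq d3); rewrite /GRing.scale/=.
have := den_gt0 (t - b1); have := den_gt0 (t + b1) => D1 D2.
by field; rewrite !gt_eqF.
Qed.

Lemma is_derive_prim_Im (t : R) : is_derive t 1 prim_Im
  (b2 / ((t - b1) ^+ 2 + b2 ^+ 2) + b2 / ((t + b1) ^+ 2 + b2 ^+ 2)).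
Proof.
have d1 (e : R) : is_derive t 1 (atan \o (fun t => (t + e) / b2))
    ((1 + ((t + e) / b2) ^+ 2)^-1 * b2^-1).
  have dq : is_derive t 1 (fun t : R => (t + e) / b2) b2^-1.
    by apply: is_derive_eq; rewrite /GRing.scale/=; ring.
  exact: (is_derive1_comp _ dq).
have d2 : is_derive t 1 (atan \o (fun t => (t - b1) / b2))
    ((1 + ((t - b1) / b2) ^+ 2)^-1 * b2^-1) by exact: (d1 (- b1)).
apply: (is_derive_eq (is_deriveD d2 (d1 b1))).
have E (u : R) : (1 + (u / b2) ^+ 2)^-1 * b2^-1 = b2 / (u ^+ 2 + b2 ^+ 2).
  have := den_gt0 u; have -> : 1 + (u / b2) ^+ 2 = (u ^+ 2 + b2 ^+ 2) / b2 ^+ 2.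
    by field; rewrite gt_eqF.
  by move=> D; field; rewrite !gt_eqF.
by rewrite !E.
Qed.

Lemma cvg_prim_Re : prim_Re n.+1%:R @[n --> \oo] --> (0 : R).
Proof.
have h0 := @cvg_harmonic R.
have L (e : R) : ln ((1 + e * harmonic n) * (1 + e * harmonic n) +
      b2 * harmonic n * (b2 * harmonic n))
    @[n --> \oo] --> (0 : R).
  have ce : 1 + e * harmonic n @[n --> \oo] --> 1 + e * 0.
    by apply: cvgD; [exact: cvg_cst|apply: cvgM => //; exact: cvg_cst].
  have cb : b2 * harmonic n @[n --> \oo] --> b2 * 0.
    by apply: cvgM => //; exact: cvg_cst.
  rewrite -(@ln1 R).
  apply: (@continuous_cvg nat R R \oo _ _ (@ln R) 1 (continuous_ln ltr01)).
  rewrite [X in _ --> X](_ : _ = (1 + e * 0) * (1 + e * 0) + b2 * 0 * (b2 * 0));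
    last by rewrite !(mulr0, addr0, mulr1).
  by apply: cvgD; exact: cvgM.
have lim : 2^-1 * (ln ((1 + - b1 * harmonic n) * (1 + - b1 * harmonic n) +
      b2 * harmonic n * (b2 * harmonic n)) -
    ln ((1 + b1 * harmonic n) * (1 + b1 * harmonic n) +
      b2 * harmonic n * (b2 * harmonic n))) @[n --> \oo] --> 2^-1 * (0 - 0 : R).
  apply: cvgM; first exact: cvg_cst.
  by apply: cvgB; exact: L.
rewrite subr0 mulr0 in lim.
apply: cvg_trans lim; apply: near_eq_cvg; apply: nearW => n.
have n0 : (0 : R) < n.+1%:R by [].
have E (e : R) : ln ((n.+1%:R + e) ^+ 2 + b2 ^+ 2) =
    ln ((1 + e * harmonic n) * (1 + e * harmonic n) +
      b2 * harmonic n * (b2 * harmonic n)) + ln (n.+1%:R ^+ 2) :> R.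
  rewrite -lnM ?posrE ?exprn_gt0//.
    congr ln; rewrite /harmonic/=; move: (n.+1%:R : R) n0 => m m0.
    by field; rewrite gt_eqF.
  by rewrite -!expr2 ltr_wpDl ?sqr_ge0// exprn_gt0// mulr_gt0// invr_gt0.
rewrite /prim_Re !E /=; ring.
Qed.

Lemma cvg_prim_Im : prim_Im n.+1%:R @[n --> \oo] --> (pi : R).
Proof.
have L (e : R) : atan ((n.+1%:R + e) / b2) @[n --> \oo] --> pi / 2.
  apply: (@cvg_comp _ _ _ (fun n => (n.+1%:R + e) / b2 : R) atan _
    (pinfty_nbhs R)); last exact: cvgy_atan.
  apply/cvgryPge => A; near=> n; rewrite ler_pdivlMr//.
  have : A * b2 - e <= n%:R by near: n; apply: nbhs_infty_ger.
  by rewrite -natr1; lra.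
rewrite [X in _ --> X](_ : _ = pi / 2 + pi / 2); last by field.
by apply: cvgD; [exact: (L (- b1))|exact: L].
Unshelve. all: by end_near. Qed.

End resolvent_primitive.

(** With t = X / Q and beta = I Z / W, one has
(t - beta) (t + beta) = A^2 (Z^2 - X^2) / (Q^2 W^2): the poles x = Z and x = - Z of
the left-hand side correspond to the poles t = beta and t = - beta of the
right-hand side. *)
Lemma symmetric_kernel_field (C : fieldType) (Z X Q A W P I : C) :
  I ^+ 2 = -1 -> W ^+ 2 = Z ^+ 2 - A ^+ 2 -> Q ^+ 2 = A ^+ 2 - X ^+ 2 ->
  2 != 0 :> C -> Z - X != 0 -> Z + X != 0 -> Q != 0 -> A != 0 -> W != 0 -> P != 0 ->
  X / Q - I * Z / W != 0 -> X / Q + I * Z / W != 0 ->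
  ((Z - X)^-1 + (Z + X)^-1) / 2 * (P * Q)^-1 =
  - I / (2 * P * W) * ((X / Q - I * Z / W)^-1 - (X / Q + I * Z / W)^-1) *
  (A ^+ 2 / Q ^+ 3).
Proof.
move=> I2 W2 Q2 two0 ZX ZX' Q0 A0 W0 P0 tb tb'.
have prod : (X / Q - I * Z / W) * (X / Q + I * Z / W) =
    A ^+ 2 * ((Z - X) * (Z + X)) / (Q ^+ 2 * W ^+ 2).
  transitivity ((X ^+ 2 * W ^+ 2 - I ^+ 2 * Z ^+ 2 * Q ^+ 2) / (Q ^+ 2 * W ^+ 2)).
    by field; rewrite W0 Q0.
  congr (_ / _); rewrite I2 Q2 W2; ring.
have -> : (X / Q - I * Z / W)^-1 - (X / Q + I * Z / W)^-1 =
    2 * (I * Z / W) / ((X / Q - I * Z / W) * (X / Q + I * Z / W)).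
  move: (X / Q) (I * Z / W) tb tb' => t b tb tb'.
  by field; rewrite tb tb'.
rewrite prod.
transitivity (- (I ^+ 2) * Z / (P * Q * ((Z - X) * (Z + X)))).
  rewrite I2; field.
  by rewrite two0 ZX ZX' Q0 P0.
field.
by rewrite two0 ZX ZX' Q0 A0 W0 P0.
Qed.

Section arcsine_transform.
Context {R : realType}.
Local Notation RT := (measurableTypeR R).
Local Notation leb := (@lebesgue_measure R).
Local Open Scope complex_scope.
Variables (a : R) (z w : R[i]).
Hypotheses (a0 : 0 < a) (z0 : 0 < complex.Im z) (w0 : 0 < complex.Im w).
Hypothesis w2 : w ^+ 2 = z ^+ 2 - a%:C ^+ 2.
Hypothesis intarc : leb.-integrable setT (EFin \o arcsine a).

Let beta : R[i] := 'i%C * z / w.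
Let kappa : R[i] := - 'i%C / (2 * pi%:C * w).

Let wn0 : w != 0.
Proof. by apply: contraTneq w0 => ->; rewrite /= ltxx. Qed.

Let pin0 : (pi%:C : R[i]) != 0.
Proof. by rewrite (inj_eq (@complexI R) _ 0) gt_eqF ?pi_gt0. Qed.

Let two0 : (2 : R[i]) != 0.
Proof. by rewrite pnatr_eq0. Qed.

Let beta_gt0 : 0 < complex.Im beta.
Proof.
rewrite /beta; have N := sqr_normc_gt0 wn0.
move: w2 w0 z0 N; case: z w => x y [p q] /=.
rewrite !expr2 /= => -[wR wI] q0 y0 N.
have -> : 0 * x - 1 * y = - y by ring.
have -> : 0 * y + 1 * x = x by ring.
have -> : - y * - (q / (p ^+ 2 + q ^+ 2)) + x * (p / (p ^+ 2 + q ^+ 2)) =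
  (y * q + x * p) / (p ^+ 2 + q ^+ 2) by ring.
rewrite divr_gt0// -(pmulr_lgt0 _ q0).
have pq : p * q = x * y by lra.
have -> : (y * q + x * p) * q = y * q ^+ 2 + x ^+ 2 * y.
  by rewrite mulrDl -[x * p * q]mulrA pq; ring.
by apply: ltr_wpDr; [rewrite mulr_ge0 ?sqr_ge0 ?ltW|rewrite mulr_gt0 ?exprn_gt0].
Qed.

Let hR := prim_Re (complex.Re beta) (complex.Im beta).
Let hI := prim_Im (complex.Re beta) (complex.Im beta).
Let dh (t : R) : R[i] := (t%:C - beta)^-1 - (t%:C + beta)^-1.

Let dhR (t : R) : is_derive t 1 hR (complex.Re (dh t)).
Proof.
apply: (is_derive_eq (is_derive_prim_Re _ beta_gt0 t)).
by rewrite /dh ReB !Re_invc ReB ReD ImB ImD /= !add0r sqrrN.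
Qed.

Let dhI (t : R) : is_derive t 1 hI (complex.Im (dh t)).
Proof.
apply: (is_derive_eq (is_derive_prim_Im _ beta_gt0 t)).
by rewrite /dh ImB !Im_invc ReB ReD ImB ImD /= !add0r sqrrN mulNr !opprK.
Qed.

Let symmetric_kernel (x : R) : x \in `]- a, a[ ->
  ((z - x%:C)^-1 + (z + x%:C)^-1) / 2 * (arcsine a x)%:C =
  kappa * dh (tanarcsin a x) * (a ^+ 2 / Num.sqrt (a ^+ 2 - x ^+ 2) ^+ 3)%:C.
Proof.
rewrite itv_sqr_lt// => xa.
rewrite /arcsine /tanarcsin; set q := Num.sqrt _.
have q0 : 0 < q by rewrite sqrtr_gt0 subr_gt0.
have q2 : q ^+ 2 = a ^+ 2 - x ^+ 2 by rewrite sqr_sqrtr// subr_ge0 ltW.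
set t := x / q.
have Im0 (u : R[i]) : 0 < complex.Im u -> u != 0.
  by move=> u0; apply: contraTneq u0 => ->; rewrite /= ltxx.
have zx : z - x%:C != 0 by apply: Im0; rewrite ImB/= subr0.
have zx' : z + x%:C != 0 by apply: Im0; rewrite ImD/= addr0.
have tb' : t%:C + beta != 0 by apply: Im0; rewrite ImD/= add0r.
have tb : t%:C - beta != 0.
  by rewrite -oppr_eq0 opprB; apply: Im0; rewrite ImB/= subr0.
have Q0 : (q%:C : R[i]) != 0 by rewrite (inj_eq (@complexI R) _ 0) gt_eqF.
have A0 : (a%:C : R[i]) != 0 by rewrite (inj_eq (@complexI R) _ 0) gt_eqF.
have Q2 : q%:C ^+ 2 = a%:C ^+ 2 - x%:C ^+ 2 :> R[i].
  by rewrite -!rmorphXn/= -rmorphB/= q2.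
have tE : t%:C = x%:C / q%:C :> R[i] by rewrite rmorphM/= fmorphV.
have -> : ((pi * q)^-1)%:C = (pi%:C * q%:C)^-1 :> R[i] by rewrite fmorphV rmorphM.
have -> : (a ^+ 2 / q ^+ 3)%:C = a%:C ^+ 2 / q%:C ^+ 3 :> R[i].
  by rewrite -!rmorphXn/= rmorphM/= fmorphV.
rewrite /dh; rewrite tE in tb tb' *.
exact: (symmetric_kernel_field (sqr_i R) w2 Q2 two0 zx zx' Q0 A0 wn0 pin0 tb tb').
Qed.

Let halfE (u : R[i]) (c : R) : u / 2 * c%:C = (c / 2)%:C * u.
Proof. by rewrite rmorphM/= fmorphV rmorph_nat mulrC mulrA mulrAC. Qed.

Let symmetric_kernel_Re (x : R) : x \in `]- a, a[ ->
  (complex.Re (z - x%:C)^-1 * arcsine a x +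
    complex.Re (z - (- x)%:C)^-1 * arcsine a (- x)) / 2 =
  (complex.Re kappa * complex.Re (dh (tanarcsin a x)) -
   complex.Im kappa * complex.Im (dh (tanarcsin a x))) *
  (a ^+ 2 / Num.sqrt (a ^+ 2 - x ^+ 2) ^+ 3).
Proof.
move=> /symmetric_kernel /(congr1 (@complex.Re R)) E.
transitivity (complex.Re (((z - x%:C)^-1 + (z + x%:C)^-1) / 2 * (arcsine a x)%:C)).
  rewrite arcsineN rmorphN/= opprK halfE ReZ ReD; ring.
rewrite E mulrC ReZ mulrC; congr (_ * _).
by case: kappa => k1 k2; case: (dh _).
Qed.

Let symmetric_kernel_Im (x : R) : x \in `]- a, a[ ->
  (complex.Im (z - x%:C)^-1 * arcsine a x +
    complex.Im (z - (- x)%:C)^-1 * arcsine a (- x)) / 2 =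
  (complex.Im kappa * complex.Re (dh (tanarcsin a x)) +
   complex.Re kappa * complex.Im (dh (tanarcsin a x))) *
  (a ^+ 2 / Num.sqrt (a ^+ 2 - x ^+ 2) ^+ 3).
Proof.
move=> /symmetric_kernel /(congr1 (@complex.Im R)) E.
transitivity (complex.Im (((z - x%:C)^-1 + (z + x%:C)^-1) / 2 * (arcsine a x)%:C)).
  rewrite arcsineN rmorphN/= opprK halfE ImZ ImD; ring.
rewrite E mulrC ImZ mulrC; congr (_ * _).
by case: kappa => k1 k2; case: (dh _) => h1 h2 /=; rewrite addrC.
Qed.

Let arcsine_integral (f : R -> R) (p q B L : R) :
  (forall x, `|f x| <= B) -> (forall x y, `|f x - f y| <= L * `|x - y|) ->
  (forall x, x \in `]- a, a[ ->
    (f x * arcsine a x + f (- x) * arcsine a (- x)) / 2 =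
    (p * complex.Re (dh (tanarcsin a x)) + q * complex.Im (dh (tanarcsin a x))) *
    (a ^+ 2 / Num.sqrt (a ^+ 2 - x ^+ 2) ^+ 3)) ->
  \int[leb]_x (f x * arcsine a x) = 2 * pi * q.
Proof.
move=> fB fL fE.
have -> : \int[leb]_x (f x * arcsine a x) =
    \int[leb]_(x in `]- a, a[) (f x * arcsine a x).
  rewrite [RHS]Rintegral_mkcond; apply: eq_Rintegral => x _.
  rewrite patchE; case: ifPn => //; rewrite notin_setE/= => /negP.
  by rewrite itv_sqr_lt// -leNgt => xa; rewrite arcsine_eq0 ?mulr0.
pose Phi t := p * hR (tanarcsin a t) + q * hI (tanarcsin a t).
apply: (@symmetric_FTC R _ Phi a _ (sinarctan a)) => //.
- exact: sinarctan_itv.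
- exact: cvg_sinarctan.
- exact: (integrable_bounded_mul _ (lipschitz_measurable fL) fB intarc).
- move=> x xa; apply: cvgM; last exact: continuous_arcsine.
  exact: lipschitz_continuous fL x.
- move=> x xa; rewrite fE//.
  have dT := is_derive_tanarcsin a0 xa.
  have d1 := is_derive1_comp (dhR _) dT.
  have d2 := is_derive1_comp (dhI _) dT.
  have d3 := is_deriveD (is_deriveZ p d1) (is_deriveZ q d2).
  by apply: (is_derive_eq d3); rewrite /GRing.scale/=; ring.
- have lim : 2 * (p * hR n.+1%:R + q * hI n.+1%:R) @[n --> \oo] -->
      2 * (p * 0 + q * pi).
    apply: cvgM; first exact: cvg_cst.
    apply: cvgD; apply: cvgM; try exact: cvg_cst.
      exact: cvg_prim_Re.
    exact: cvg_prim_Im.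
  rewrite (_ : 2 * pi * q = 2 * (p * 0 + q * pi)); last by ring.
  apply: cvg_trans lim; apply: near_eq_cvg; apply: nearW => n.
  rewrite /Phi tanarcsinN sinarctanK// /hR /hI prim_ReN prim_ImN; ring.
Qed.

(** In the variable t = x / sqrt (a^2 - x^2) the even part of the integrand is
kappa * (1 / (t - beta) - 1 / (t + beta)) dt with beta = i z / w in the upper
half-plane. From -oo to +oo the primitive gains 2 i pi, and 2 i pi kappa = 1 / w. *)
Lemma arcsine_transform : density_transform (arcsine a) z = w^-1.
Proof.
have E : w^-1 = (2 * pi)%:C * 'i%C * kappa.
  rewrite /kappa rmorphM/= rmorph_nat; move: (pi%:C) pin0 => P P0.
  have -> : 2 * P * 'i%C * (- 'i%C / (2 * P * w)) = - ('i%C ^+ 2) / w.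
    by field; rewrite wn0 P0.
  by rewrite sqr_i opprK mul1r.
rewrite E /density_transform.
rewrite (@arcsine_integral _ (complex.Re kappa) (- complex.Im kappa) _ _
  (cauchy_kernel_Re_bound z0) (cauchy_kernel_Re_lipschitz z0)); last first.
  by move=> x xa; rewrite symmetric_kernel_Re// mulNr.
rewrite (@arcsine_integral _ (complex.Im kappa) (complex.Re kappa) _ _
  (cauchy_kernel_Im_bound z0) (cauchy_kernel_Im_lipschitz z0)); last first.
  by move=> x xa; rewrite symmetric_kernel_Im.
case: kappa => k1 k2; apply: complex_eqP => /=; ring.
Qed.

End arcsine_transform.

(** * Complex integrals and measures with a density *)

Section complex_integral.
Context {R : realType}.
Local Notation RT := (measurableTypeR R).
Local Notation leb := (@lebesgue_measure R).
Local Open Scope complex_scope.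
Implicit Types (f g : R -> R[i]) (k : R -> R).

Definition cintegrable f :=
  leb.-integrable setT (EFin \o (fun x => complex.Re (f x))) /\
  leb.-integrable setT (EFin \o (fun x => complex.Im (f x))).

Definition cint f : R[i] :=
  (\int[leb]_x complex.Re (f x)) +i* (\int[leb]_x complex.Im (f x)).

Let integrable_lin (u v : R -> R) (p q : R) :
  leb.-integrable setT (EFin \o u) -> leb.-integrable setT (EFin \o v) ->
  leb.-integrable setT (EFin \o (fun x => p * u x + q * v x)).
Proof.
move=> iu iv.
have i1 := integrableZl measurableT p iu.
have i2 := integrableZl measurableT q iv.
by have := integrableD measurableT i1 i2; apply: eq_integrable.
Qed.

Let Rintegral_lin (u v : R -> R) (p q : R) :
  leb.-integrable setT (EFin \o u) -> leb.-integrable setT (EFin \o v) ->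
  \int[leb]_x (p * u x + q * v x) = p * \int[leb]_x u x + q * \int[leb]_x v x.
Proof.
move=> iu iv.
have i1 : leb.-integrable setT (EFin \o (fun x => p * u x)).
  by have := integrableZl measurableT p iu; apply: eq_integrable.
have i2 : leb.-integrable setT (EFin \o (fun x => q * v x)).
  by have := integrableZl measurableT q iv; apply: eq_integrable.
by rewrite RintegralD// !RintegralZl.
Qed.

Lemma eq_cint f g : f =1 g -> cint f = cint g.
Proof. by move=> fg; congr (_ +i* _); apply: eq_Rintegral => x _; rewrite fg. Qed.

Lemma cintegrableZ (c : R[i]) f : cintegrable f -> cintegrable (fun x => c * f x).
Proof.
case: c => p q [fR fI]; split.
  have := integrable_lin p (- q) fR fI; apply: eq_integrable => // x _ /=.
  by congr EFin; case: (f x) => u v /=; rewrite mulNr.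
have := integrable_lin p q fI fR; apply: eq_integrable => // x _ /=.
by congr EFin; case: (f x) => u v.
Qed.

Lemma cintZ (c : R[i]) f : cintegrable f -> cint (fun x => c * f x) = c * cint f.
Proof.
case: c => p q [fR fI]; apply: complex_eqP => /=.
  rewrite -mulNr -Rintegral_lin//.
  by apply: eq_Rintegral => x _; case: (f x) => u v /=; rewrite mulNr.
rewrite -Rintegral_lin//.
by apply: eq_Rintegral => x _; case: (f x) => u v.
Qed.

Lemma cintegrableD f g : cintegrable f -> cintegrable g ->
  cintegrable (fun x => f x + g x).
Proof.
move=> [fR fI] [gR gI]; split.
  have := integrable_lin 1 1 fR gR; apply: eq_integrable => // x _ /=.
  by rewrite ReD !mul1r.
have := integrable_lin 1 1 fI gI; apply: eq_integrable => // x _ /=.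
by rewrite ImD !mul1r.
Qed.

Lemma cintD f g : cintegrable f -> cintegrable g ->
  cint (fun x => f x + g x) = cint f + cint g.
Proof.
move=> [fR fI] [gR gI]; apply: complex_eqP => /=.
  by rewrite -RintegralD//; apply: eq_Rintegral => x _; rewrite ReD.
by rewrite -RintegralD//; apply: eq_Rintegral => x _; rewrite ImD.
Qed.

Lemma cintegrable_real k : leb.-integrable setT (EFin \o k) ->
  cintegrable (fun x => (k x)%:C).
Proof. by move=> ik; split => //=; exact: integrable0. Qed.

Lemma cint_real k : cint (fun x => (k x)%:C) = (\int[leb]_x k x)%:C.
Proof. by apply: complex_eqP => //=; rewrite Rintegral_cst// mul0r. Qed.

Lemma density_transformE k z :
  density_transform k z = cint (fun x => (k x)%:C * (z - x%:C)^-1).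
Proof.
by apply: complex_eqP => /=; apply: eq_Rintegral => x _; rewrite ?ReZ ?ImZ mulrC.
Qed.

Lemma cintegrable_kernel k z : 0 < complex.Im z ->
  leb.-integrable setT (EFin \o k) -> cintegrable (fun x => (k x)%:C * (z - x%:C)^-1).
Proof.
move=> z0 ik; split.
  have := integrable_bounded_mul measurableT
    (lipschitz_measurable (cauchy_kernel_Re_lipschitz z0)) (cauchy_kernel_Re_bound z0) ik.
  by apply: eq_integrable => // x _ /=; rewrite ReZ mulrC.
have := integrable_bounded_mul measurableT
  (lipschitz_measurable (cauchy_kernel_Im_lipschitz z0)) (cauchy_kernel_Im_bound z0) ik.
by apply: eq_integrable => // x _ /=; rewrite ImZ mulrC.
Qed.

End complex_integral.

Section density.
Context {R : realType}.
Local Notation RT := (measurableTypeR R).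
Local Notation leb := (@lebesgue_measure R).

(** g is a version of the Radon-Nikodym derivative of P. *)
Lemma Rintegral_density (P : probability RT R) (g f : R -> R) (B : R) :
  (forall x, 0 <= g x) -> leb.-integrable setT (EFin \o g) ->
  (forall A, measurable A -> P A = (\int[leb]_(x in A) (g x)%:E)%E) ->
  measurable_fun (setT : set RT) f -> (forall x, `|f x| <= B) ->
  \int[P]_x f x = \int[leb]_x (f x * g x).
Proof.
move=> g0 ig PE mf fB.
have domP : P `<< leb.
  apply/null_content_dominatesP => A mA A0; rewrite PE//.
  by apply: null_set_integral => //; apply: measurable_funTS; exact: measurable_int ig.
have iP := integrable_bounded P mf fB.
congr fine; rewrite -(Radon_Nikodym_change_of_variables domP)//=.
apply: ae_eq_integral => //.
- apply: emeasurable_funM; first exact: measurable_int iP.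
  apply: (measurable_int leb).
  exact: Radon_Nikodym_integrable.
- exact: measurable_int (integrable_bounded_mul measurableT mf fB ig).
- rewrite (_ : (fun x => (f x * g x)%:E) = ((EFin \o f) \* (EFin \o g))%E)//.
  apply: ae_eqe_mul2l.
  rewrite Radon_NikodymE//=.
  case: cid => /= h [h1 h2 h3].
  apply: integral_ae_eq => //=; first exact: measurable_int ig.
  by move=> E _ mE; rewrite -h3// PE.
Qed.

Lemma cauchy_transform_density (P : probability RT R) (g : R -> R) z :
  (forall x, 0 <= g x) -> leb.-integrable setT (EFin \o g) ->
  (forall A, measurable A -> P A = (\int[leb]_(x in A) (g x)%:E)%E) ->
  0 < complex.Im z -> cauchy_transform P z = density_transform g z.
Proof.
move=> g0 ig PE z0; apply: complex_eqP => /=.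
  exact: (Rintegral_density g0 ig PE
    (lipschitz_measurable (cauchy_kernel_Re_lipschitz z0)) (cauchy_kernel_Re_bound z0)).
exact: (Rintegral_density g0 ig PE
  (lipschitz_measurable (cauchy_kernel_Im_lipschitz z0)) (cauchy_kernel_Im_bound z0)).
Qed.

End density.

Section konno_arcsine.
Context {R : realType}.
Local Notation RT := (measurableTypeR R).
Local Notation leb := (@lebesgue_measure R).

Lemma konno_pdf_arcsine (r x : R) : 0 < r < 1 ->
  konno_pdf r x * (1 - x ^+ 2) = Num.sqrt (1 - r ^+ 2) * arcsine r x.
Proof.
move=> /andP[r0 r1]; rewrite /konno_pdf patchE; case: ifPn; last first.
  rewrite notin_setE/= => /negP; rewrite (itv_sqr_lt r0) -leNgt => rx.
  by rewrite arcsine_eq0// mul0r mulr0.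
rewrite inE/= (itv_sqr_lt r0) => xr; rewrite /arcsine.
have q0 : 0 < Num.sqrt (r ^+ 2 - x ^+ 2) by rewrite sqrtr_gt0 subr_gt0.
have x1 : 0 < 1 - x ^+ 2 by nra.
have := pi_gt0 R; move: (pi : R) => p p0.
by field; rewrite !gt_eqF.
Qed.

Lemma integrable_konno_pdf (r : R) : 0 < r < 1 ->
  leb.-integrable setT (EFin \o konno_pdf r).
Proof.
move=> r01; apply/integrableP; split.
  by apply/measurable_EFinP; exact: measurable_konno_pdf.
rewrite (@eq_integral _ RT R _ _ (fun x => (konno_pdf r x)%:E)).
  by rewrite integral_konno_pdf// ltry.
by move=> x _; rewrite /= ger0_norm// konno_pdf_ge0.
Qed.

(** The arcsine density is, up to the factor 1 / sqrt (1 - a^2), bounded by the Konno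
density of parameter a, whose integral is 1. *)
Lemma integrable_arcsine (a : R) : 0 < a < 1 ->
  leb.-integrable setT (EFin \o arcsine a).
Proof.
move=> a01; have /andP[a0 a1] := a01.
have s0 : 0 < Num.sqrt (1 - a ^+ 2) by rewrite sqrtr_gt0; nra.
have arcE x : arcsine a x = (Num.sqrt (1 - a ^+ 2))^-1 * (konno_pdf a x * (1 - x ^+ 2)).
  by rewrite konno_pdf_arcsine// mulKf// gt_eqF.
have := integrableZl measurableT (Num.sqrt (1 - a ^+ 2))^-1 (integrable_konno_pdf a01).
apply: le_integrable => //.
  apply/measurable_EFinP.
  rewrite (_ : arcsine a = fun x => (Num.sqrt (1 - a ^+ 2))^-1 *
    (konno_pdf a x * (1 - x ^+ 2))); last by apply/funext.
  apply: measurable_funM => //; apply: measurable_funM.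
    exact: measurable_konno_pdf.
  by apply: measurable_funB => //; exact: measurable_funX.
move=> x _ /=; rewrite lee_fin arcE !normrM; apply: ler_wpM2l => //.
have [ax|xa] := leP (a ^+ 2) (x ^+ 2).
  by rewrite -normrM konno_pdf_arcsine// arcsine_eq0// mulr0 normr0.
apply: ler_piMr => //; rewrite ler_norml.
by apply/andP; split; have := sqr_ge0 x; nra.
Qed.

End konno_arcsine.

(** * Cauchy transform of the Konno density and its Nevanlinna density *)

Section konno_transform.
Context {R : realType}.
Local Notation RT := (measurableTypeR R).
Local Notation leb := (@lebesgue_measure R).
Local Open Scope complex_scope.

Lemma upper_neq0 (z : R[i]) : 0 < complex.Im z -> z != 0.
Proof. by move=> z0; apply: contraTneq z0 => ->; rewrite /= ltxx. Qed.

Lemma real_complex_neq0 (x : R) : x != 0 -> (x%:C : R[i]) != 0.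
Proof. by rewrite (inj_eq (@complexI R) _ 0). Qed.

Lemma exists_upper_sqrt (a : R) (z : R[i]) : 0 < a -> 0 < complex.Im z ->
  exists w : R[i], w ^+ 2 = z ^+ 2 - a%:C ^+ 2 /\ 0 < complex.Im w.
Proof.
move=> a0 z0; have := sqr_sqrtc (z ^+ 2 - a%:C ^+ 2); move: (sqrtc _) => w w2.
have [wn|wp|wI0] := ltgtP (complex.Im w) 0.
- exists (- w); rewrite sqrrN; split=> //.
  by move: wn; case: (w) => x y /=; rewrite oppr_gt0.
- by exists w.
(* If w were real, z would be imaginary and w^2 = z^2 - a^2 negative. *)
- exfalso; move: w2 wI0 z0; case: w z => x y [u v] /=.
  rewrite !expr2 /= => -[wR wI] y0 v0; rewrite {}y0 in wR wI.
  have uv : u * v = 0 by lra.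
  have u0 : u = 0 by apply: (mulIf (lt0r_neq0 v0)); rewrite uv mul0r.
  by rewrite u0 in wR; nra.
Qed.

Lemma integral_odd0 (f : R -> R) (a : R) : 0 < a ->
  leb.-integrable setT (EFin \o f) -> (forall x, x \notin `]- a, a[ -> f x = 0) ->
  (forall x, x \in `]- a, a[ -> {for x, continuous f}) ->
  (forall x, f (- x) = - f x) -> \int[leb]_x f x = 0.
Proof.
move=> a0 intf f0 cf fN.
have -> : \int[leb]_x f x = \int[leb]_(x in `]- a, a[) f x.
  rewrite [RHS]Rintegral_mkcond; apply: eq_Rintegral => x _.
  by rewrite patchE; case: ifPn => //; rewrite notin_setE/= => /negP/f0.
apply: (@symmetric_FTC R f (cst 0) a _ (sinarctan a)) => //.
- exact: sinarctan_itv.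
- exact: cvg_sinarctan.
- exact: integrableS intf.
- by move=> x _; rewrite fN subrr mul0r; exact: is_derive_cst.
- by under eq_fun do rewrite subrr; exact: cvg_cst.
Qed.

Lemma integral_id_konno (r : R) : 0 < r < 1 ->
  leb.-integrable setT (EFin \o (fun x => x * konno_pdf r x)) /\
  \int[leb]_x (x * konno_pdf r x) = 0.
Proof.
move=> r01; have /andP[r0 r1] := r01.
have konno0 x : x \notin `]- r, r[ -> konno_pdf r x = 0.
  by move=> xr; rewrite /konno_pdf patchE; case: ifPn => //; rewrite inE/= (negbTE xr).
have intx : leb.-integrable setT (EFin \o (fun x => x * konno_pdf r x)).
  have := integrable_konno_pdf r01; apply: le_integrable => //.
    by apply/measurable_EFinP; apply: measurable_funM => //; exact: measurable_konno_pdf.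
  move=> x _ /=; rewrite lee_fin.
  have [xr|/konno0->] := boolP (x \in `]- r, r[); last by rewrite mulr0.
  rewrite normrM ler_piMl//; move: xr; rewrite in_itv/= -ltr_norml; lra.
split => //; apply: (integral_odd0 r0 intx).
- by move=> x /konno0->; rewrite mulr0.
- move=> x xr.
  pose h (y : R) := y * (Num.sqrt (1 - r ^+ 2) * arcsine r y * (1 - y ^+ 2)^-1).
  have x1 : 1 - x ^+ 2 != 0.
    by move: xr; rewrite (itv_sqr_lt r0) => xr; rewrite gt_eqF//; nra.
  have ch : {for x, continuous h}.
    apply: cvgM; first exact: cvg_id.
    apply: cvgM.
      by apply: cvgM; [exact: cvg_cst|exact: continuous_arcsine].
    apply: cvgV => //.
    by apply: cvgB; [exact: cvg_cst|exact: exprn_continuous].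
  have hx y : y \in `]- r, r[ -> h y = y * konno_pdf r y.
    rewrite (itv_sqr_lt r0) => yr; rewrite /h -konno_pdf_arcsine// mulfK//.
    by rewrite gt_eqF//; nra.
  rewrite /prop_for /continuous_at -(hx x xr); apply: cvg_trans ch.
  apply: near_eq_cvg; near=> y; apply: hx.
  by near: y; exact: near_in_itvoo.
- move=> x; rewrite mulNr /konno_pdf !patchE.
  have -> : (- x \in `]-r, r[%classic) = (x \in `]-r, r[%classic).
    by apply/idP/idP; rewrite !inE/= !(itv_sqr_lt r0) sqrrN.
  by case: ifP => _; rewrite ?mulr0 ?oppr0// sqrrN.
Unshelve. all: by end_near. Qed.

(** Partial fractions in x give
(1 - z^2) / ((1 - x^2) (z - x)) = 1 / (z - x) - (z + x) / (1 - x^2).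
The first term leads to the arcsine density; the second one contributes - z,
because the Konno law has mass 1 and mean 0. *)
Lemma konno_transform (r : R) (z w : R[i]) : 0 < r < 1 ->
  0 < complex.Im z -> 0 < complex.Im w -> w ^+ 2 = z ^+ 2 - r%:C ^+ 2 ->
  (1 - z ^+ 2) * density_transform (konno_pdf r) z =
  (Num.sqrt (1 - r ^+ 2))%:C / w - z.
Proof.
move=> r01 z0 w0 w2; have /andP[r0 _] := r01.
have iK := integrable_konno_pdf r01.
have iA := integrable_arcsine r01.
have [ixK xK0] := integral_id_konno r01.
have K1 : \int[leb]_x konno_pdf r x = 1 by rewrite /Rintegral integral_konno_pdf.
set s := Num.sqrt _.
have c1 := cintegrable_kernel z0 iA.
have c2 := cintegrable_real iK.
have c3 := cintegrable_real ixK.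
rewrite density_transformE -cintZ; last exact: cintegrable_kernel.
rewrite (@eq_cint _ _ (fun x => s%:C * ((arcsine r x)%:C * (z - x%:C)^-1) +
    ((- z) * (konno_pdf r x)%:C + (-1) * (x * konno_pdf r x)%:C))); last first.
  move=> x.
  have zx : z - x%:C != 0 by apply: upper_neq0; rewrite ImB/= subr0.
  have kE : (konno_pdf r x)%:C * (1 - x%:C ^+ 2) = s%:C * (arcsine r x)%:C :> R[i].
    rewrite -rmorphM/= -konno_pdf_arcsine// rmorphM/=.
    by rewrite rmorphB/= rmorphXn rmorph1.
  rewrite [s%:C * _]mulrA -kE rmorphM/=; move: (x%:C) (konno_pdf r x)%:C zx => X k zx.
  by field.
rewrite cintD; [|exact: cintegrableZ|by apply: cintegrableD; exact: cintegrableZ].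
rewrite cintD; [|exact: cintegrableZ|exact: cintegrableZ].
rewrite !cintZ// !cint_real xK0 K1 -density_transformE.
rewrite (@arcsine_transform R r z w)//.
by rewrite mulr0 addr0 mulr1.
Qed.

(** Partial fractions in x: since a^2 + b^2 = c^2, the product of z^2 + b^2 and
(a^2 - x^2) / ((x^2 + b^2) (z - x)) is
(a^2 - z^2) / (z - x) + c^2 (z + x) / (x^2 + b^2). *)
Lemma nevanlinna_density_kernel (s c a b x k : R) (z : R[i]) :
  z - x%:C != 0 -> x ^+ 2 + b ^+ 2 != 0 -> b != 0 -> a ^+ 2 + b ^+ 2 = c ^+ 2 ->
  (z ^+ 2 + b%:C ^+ 2) *
    ((s * c ^+ 2 * ((a ^+ 2 - x ^+ 2) / (x ^+ 2 + b ^+ 2)) * k)%:C * (z - x%:C)^-1) =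
  - ((s * c ^+ 2)%:C * (z ^+ 2 - a%:C ^+ 2)) * (k%:C * (z - x%:C)^-1) +
    (- (s * c ^+ 4)%:C * (- (x / (x ^+ 2 + b ^+ 2)) * k)%:C +
     - ((s * c ^+ 4)%:C * z / b%:C) * (- (b / (x ^+ 2 + b ^+ 2)) * k)%:C).
Proof.
move=> zx /real_complex_neq0 D0 /real_complex_neq0 B0 ab.
have -> : c ^+ 4 = c ^+ 2 * c ^+ 2 by ring.
rewrite -!ab.
rewrite !(rmorphXn, rmorphN, fmorphV, rmorphD, rmorphB, rmorphM)/= in D0 *.
move: (x%:C) (k%:C) (a%:C) (b%:C) (s%:C) zx D0 B0 => X K A B S zx D0 B0.
by field; rewrite zx D0 B0.
Qed.

(** Needed at one point of the imaginary axis, where a factor of the partial fraction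
decomposition of [nevanlinna_density] vanishes. *)
Lemma density_transform_cvg (k : R -> R) (z : R[i]) : 0 < complex.Im z ->
  leb.-integrable setT (EFin \o k) ->
  complex.Re (density_transform k (z + 0 +i* harmonic n)) @[n --> \oo] -->
    complex.Re (density_transform k z) /\
  complex.Im (density_transform k (z + 0 +i* harmonic n)) @[n --> \oo] -->
    complex.Im (density_transform k z).
Proof.
move=> z0 ik.
pose u n : R[i] := z + 0 +i* harmonic n.
have un0 n : 0 < complex.Im (u n) by rewrite ImD/= addr_gt0.
have uz n : (complex.Im (u n))^-1 <= (complex.Im z)^-1.
  by rewrite lef_pV2 ?posrE// ImD/= lerDl ltW.
have lim x : complex.Re (u n - x%:C)^-1 @[n --> \oo] --> complex.Re (z - x%:C)^-1 /\
    complex.Im (u n - x%:C)^-1 @[n --> \oo] --> complex.Im (z - x%:C)^-1.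
  apply: cvg_invc; first by apply: upper_neq0; rewrite ImB/= subr0.
    by under eq_fun do rewrite ReB ReD/= addr0; rewrite ReB; exact: cvg_cst.
  have -> : complex.Im (z - x%:C) = complex.Im z + 0 by rewrite ImB/= subr0 addr0.
  under eq_fun do rewrite ImB ImD/= subr0.
  by apply: cvgD; [exact: cvg_cst|exact: cvg_harmonic].
have mk : measurable_fun (setT : set RT) k by apply/measurable_EFinP; exact: measurable_int ik.
have DCT (f : nat -> R -> R) (g : R -> R) :
    (forall n, measurable_fun (setT : set RT) (f n)) ->
    leb.-integrable setT (EFin \o (fun x => g x * k x)) ->
    (forall x, f n x @[n --> \oo] --> g x) ->
    (forall n x, `|f n x| <= (complex.Im z)^-1) ->
    \int[leb]_x (f n x * k x) @[n --> \oo] --> \int[leb]_x (g x * k x).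
  move=> mf ig fg fB.
  apply: fine_cvg.
  rewrite -[X in _ --> X]/((\int[leb]_x (g x * k x))%:E).
  rewrite [X in _ --> X](_ : _ = (\int[leb]_x (g x * k x)%:E)%E); last first.
    by rewrite fineK//; exact: integrable_fin_num.
  apply: (@dominated_cvg _ RT R leb setT measurableT _ _
    (fun x => ((complex.Im z)^-1 * `|k x|)%:E)) => //.
  - by move=> n; apply/measurable_EFinP; exact: measurable_funM.
  - move=> x _; apply: cvg_EFin; first exact: nearW.
    by apply: cvgM; [exact: fg|exact: cvg_cst].
  - exact: (integrableZl measurableT _ (integrable_norm ik)).
  - by move=> n x _; rewrite /= lee_fin normrM ler_wpM2r.
split; apply: DCT.
- by move=> n; exact: (lipschitz_measurable (cauchy_kernel_Re_lipschitz (un0 n))).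
- exact: (integrable_bounded_mul measurableT
    (lipschitz_measurable (cauchy_kernel_Re_lipschitz z0)) (cauchy_kernel_Re_bound z0) ik).
- by move=> x; have [] := lim x.
- by move=> n x; exact: le_trans (cauchy_kernel_Re_bound (un0 n) x) (uz n).
- by move=> n; exact: (lipschitz_measurable (cauchy_kernel_Im_lipschitz (un0 n))).
- exact: (integrable_bounded_mul measurableT
    (lipschitz_measurable (cauchy_kernel_Im_lipschitz z0)) (cauchy_kernel_Im_bound z0) ik).
- by move=> x; have [] := lim x.
- by move=> n x; exact: le_trans (cauchy_kernel_Im_bound (un0 n) x) (uz n).
Qed.

Lemma sqr_imaginary (v y a : R) : v ^+ 2 = y ^+ 2 + a ^+ 2 ->
  (0 +i* v) ^+ 2 = (0 +i* y) ^+ 2 - a%:C ^+ 2.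
Proof.
move=> v2; apply: complex_eqP; rewrite !expr2/= -?expr2; last by ring.
by rewrite v2; ring.
Qed.

Lemma sqr_imaginary_neq0 (b h : R) : 0 < b -> 0 < h ->
  (0 +i* (b + h)) ^+ 2 + b%:C ^+ 2 != 0.
Proof.
move=> b0 h0; apply/eqP => /(congr1 (@complex.Re R)); rewrite !expr2/=.
by nra.
Qed.

(** The measure with this density has z - F(z) as its Cauchy transform, for F
attached to the law D_c(K_r). Its support is [-c r, c r], outside of which the
square root is 0. *)
Definition nevanlinna_density (r c x : R) : R :=
  Num.sqrt (1 - r ^+ 2) * c ^+ 2 / pi * Num.sqrt ((c * r) ^+ 2 - x ^+ 2) /
  (x ^+ 2 + (c * Num.sqrt (1 - r ^+ 2)) ^+ 2).

Section nevanlinna_density.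
Variables r c : R.
Hypotheses (r01 : 0 < r < 1) (c01 : 0 < c <= 1).
Let s := Num.sqrt (1 - r ^+ 2).
Let a := c * r.
Let b := c * s.

Let s0 : 0 < s. Proof. by have /andP[? ?] := r01; rewrite sqrtr_gt0; nra. Qed.
Let s2 : s ^+ 2 = 1 - r ^+ 2.
Proof. by have /andP[? ?] := r01; rewrite sqr_sqrtr//; nra. Qed.
Let c0 : 0 < c. Proof. by have /andP[] := c01. Qed.
Let a01 : 0 < a < 1.
Proof.
by have /andP[? ?] := r01; have /andP[? ?] := c01; rewrite /a; apply/andP; split; nra.
Qed.
Let a0 : 0 < a. Proof. by have /andP[] := a01. Qed.
Let b0 : 0 < b. Proof. exact: mulr_gt0. Qed.
Let ab : a ^+ 2 + b ^+ 2 = c ^+ 2.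
Proof. by rewrite /a /b !exprMn s2; ring. Qed.

Let zb : R[i] := 0 +i* b.
Let kR x := complex.Re (zb - x%:C)^-1.
Let kI x := complex.Im (zb - x%:C)^-1.

Let iA := integrable_arcsine a01.

Let kIE x : kI x = - (b / (x ^+ 2 + b ^+ 2)).
Proof. by rewrite /kI cauchy_kernel_Im/= sub0r sqrrN. Qed.

Let kRE x : kR x = - (x / (x ^+ 2 + b ^+ 2)).
Proof. by rewrite /kR cauchy_kernel_Re/= sub0r sqrrN mulNr. Qed.

Let ikR : leb.-integrable setT (EFin \o (fun x => kR x * arcsine a x)).
Proof.
exact: (integrable_bounded_mul measurableT
  (lipschitz_measurable (@cauchy_kernel_Re_lipschitz _ zb b0))
  (@cauchy_kernel_Re_bound _ zb b0) iA).
Qed.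

Let ikI : leb.-integrable setT (EFin \o (fun x => kI x * arcsine a x)).
Proof.
exact: (integrable_bounded_mul measurableT
  (lipschitz_measurable (@cauchy_kernel_Im_lipschitz _ zb b0))
  (@cauchy_kernel_Im_bound _ zb b0) iA).
Qed.

(** These are the real and imaginary parts of the arcsine transform at i b, where
w = i c. They provide the integrals of x / (x^2 + b^2) and b / (x^2 + b^2). *)
Let int_zb : \int[leb]_x (kR x * arcsine a x) = 0 /\
  \int[leb]_x (kI x * arcsine a x) = - c^-1.
Proof.
have : density_transform (arcsine a) zb = (0 +i* c)^-1.
  apply: arcsine_transform => //=.
  by apply: complex_eqP; rewrite !expr2/=; [have := ab; rewrite !expr2; lra|ring].
move=> [-> ->]; split; first by rewrite mul0r.
by rewrite expr0n/= add0r; field; rewrite gt_eqF.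
Qed.

Let nevanlinna_densityE x : nevanlinna_density r c x = s * c ^+ 2 * ((a ^+ 2 - x ^+ 2) / (x ^+ 2 + b ^+ 2)) * arcsine a x.
Proof.
rewrite /nevanlinna_density -/s -/a -/b.
have [ax|xa] := leP (a ^+ 2) (x ^+ 2).
  by rewrite arcsine_eq0// ler0_sqrtr ?subr_le0// !(mulr0, mul0r).
have q0 : 0 < Num.sqrt (a ^+ 2 - x ^+ 2) by rewrite sqrtr_gt0 subr_gt0.
have q2 : a ^+ 2 - x ^+ 2 = Num.sqrt (a ^+ 2 - x ^+ 2) ^+ 2.
  by rewrite sqr_sqrtr// subr_ge0 ltW.
have D0 : 0 < x ^+ 2 + b ^+ 2 by rewrite ltr_wpDl ?sqr_ge0// exprn_gt0.
rewrite /arcsine [in RHS]q2 sqrtr_sqr (ger0_norm (ltW q0)).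
have := pi_gt0 R; move: (pi : R) (Num.sqrt _) q0 => p q q0 p0.
by field; rewrite !gt_eqF.
Qed.

Lemma nevanlinna_density_eq0 x : x \notin `]- 1, 1] -> nevanlinna_density r c x = 0.
Proof.
move=> x1; rewrite nevanlinna_densityE arcsine_eq0 ?mulr0//.
have /andP[_ a1] := a01.
have a2 : a ^+ 2 <= 1 by rewrite exprn_ile1 ?ltW.
apply: le_trans a2 _; move: x1.
rewrite in_itv/= negb_and -!leNgt -ltNge => /orP[x1|x1]; nra.
Qed.

Lemma integrable_nevanlinna_density : leb.-integrable setT (EFin \o nevanlinna_density r c).
Proof.
have i1 := integrableZl measurableT (- (s * c ^+ 4 / b)) ikI.
have i2 := integrableZl measurableT (- (s * c ^+ 2)) iA.
have := integrableD measurableT i1 i2; apply: eq_integrable => // x _ /=.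
congr EFin; rewrite nevanlinna_densityE kIE.
have -> : a ^+ 2 - x ^+ 2 = c ^+ 2 - (x ^+ 2 + b ^+ 2) by rewrite -ab; ring.
have D0 : 0 < x ^+ 2 + b ^+ 2 by rewrite ltr_wpDl ?sqr_ge0// exprn_gt0.
move: (x ^+ 2 + b ^+ 2) D0 => D D0.
by field; rewrite !gt_eqF.
Qed.

Let nevanlinna_density_transform_mul (z w : R[i]) :
  0 < complex.Im z -> 0 < complex.Im w -> w ^+ 2 = z ^+ 2 - a%:C ^+ 2 ->
  (z ^+ 2 + b%:C ^+ 2) * density_transform (nevanlinna_density r c) z = (c ^+ 2)%:C * (z - s%:C * w).
Proof.
move=> z0 w0 w2.
have [I1 I2] := int_zb.
have c1 := cintegrable_kernel z0 iA.
have c2 := cintegrable_real ikR.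
have c3 := cintegrable_real ikI.
have B0 := real_complex_neq0 (lt0r_neq0 b0).
have C0 := real_complex_neq0 (lt0r_neq0 c0).
have S0 := real_complex_neq0 (lt0r_neq0 s0).
rewrite density_transformE -cintZ; last exact: cintegrable_kernel integrable_nevanlinna_density.
rewrite (@eq_cint _ _ (fun x =>
    - ((s * c ^+ 2)%:C * w ^+ 2) * ((arcsine a x)%:C * (z - x%:C)^-1) +
    (- (s * c ^+ 4)%:C * (kR x * arcsine a x)%:C +
     - ((s * c ^+ 4)%:C * z / b%:C) * (kI x * arcsine a x)%:C))); last first.
  move=> x.
  have zx : z - x%:C != 0 by apply: upper_neq0; rewrite ImB/= subr0.
  have D0 : 0 < x ^+ 2 + b ^+ 2 by rewrite ltr_wpDl ?sqr_ge0// exprn_gt0.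
  rewrite nevanlinna_densityE kRE kIE w2.
  exact: (nevanlinna_density_kernel s (arcsine a x) zx (lt0r_neq0 D0) (lt0r_neq0 b0) ab).
rewrite cintD; [|exact: cintegrableZ|by apply: cintegrableD; exact: cintegrableZ].
rewrite cintD; [|exact: cintegrableZ|exact: cintegrableZ].
rewrite !cintZ// !cint_real I1 I2 -density_transformE.
rewrite (@arcsine_transform R a z w)//.
have W0 := upper_neq0 w0.
rewrite /b !(rmorphM, rmorphN, fmorphV, rmorphXn)/= rmorph0 in B0 *.
by field; rewrite W0 C0 S0.
Qed.

Let upper_sum_neq0 (z w : R[i]) : 0 < complex.Im z -> 0 < complex.Im w ->
  z + s%:C * w != 0.
Proof. by move=> z0 w0; apply: upper_neq0; rewrite ImD ImZ addr_gt0 ?mulr_gt0. Qed.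

Let nevanlinna_density_transform_generic (z w : R[i]) :
  0 < complex.Im z -> 0 < complex.Im w -> w ^+ 2 = z ^+ 2 - a%:C ^+ 2 ->
  z ^+ 2 + b%:C ^+ 2 != 0 ->
  density_transform (nevanlinna_density r c) z = (a ^+ 2)%:C / (z + s%:C * w).
Proof.
move=> z0 w0 w2 zb0.
have D := upper_sum_neq0 z0 w0.
apply: (mulfI zb0); apply: (mulIf D); rewrite -[RHS]mulrA mulfVK//.
rewrite (nevanlinna_density_transform_mul z0 w0 w2).
have -> : (c ^+ 2)%:C * (z - s%:C * w) * (z + s%:C * w) =
   (c ^+ 2)%:C * (z ^+ 2 - s%:C ^+ 2 * w ^+ 2) by ring.
have S2 : s%:C ^+ 2 = 1 - r%:C ^+ 2 :> R[i].
  by rewrite -!rmorphXn/= s2 rmorphB rmorph1.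
rewrite w2 /a /b !(rmorphXn, rmorphM)/= !exprMn S2; ring.
Qed.

Let nevanlinna_density_transform_zb : density_transform (nevanlinna_density r c) zb = (a ^+ 2)%:C / (zb + s%:C * (0 +i* c)).
Proof.
pose v n := Num.sqrt ((b + harmonic n) ^+ 2 + a ^+ 2).
have h0 n : 0 < harmonic n :> R by rewrite /harmonic/= invr_gt0.
have v0 n : 0 < v n by rewrite sqrtr_gt0 ltr_wpDl ?sqr_ge0 ?exprn_gt0.
have v2 n : v n ^+ 2 = (b + harmonic n) ^+ 2 + a ^+ 2.
  by rewrite sqr_sqrtr// addr_ge0 ?sqr_ge0.
have bn n : 0 < b + harmonic n by rewrite addr_gt0.
have E n : density_transform (nevanlinna_density r c) (zb + 0 +i* harmonic n) =
    (a ^+ 2)%:C / (zb + 0 +i* harmonic n + s%:C * (0 +i* v n)).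
  apply: nevanlinna_density_transform_generic; [exact: bn|exact: v0| |].
    rewrite (sqr_imaginary (v2 n)); congr (_ ^+ 2 - _).
    by apply: complex_eqP; rewrite /= ?addr0.
  have -> : zb + 0 +i* harmonic n = 0 +i* (b + harmonic n).
    by apply: complex_eqP; rewrite /= ?addr0.
  exact: sqr_imaginary_neq0.
have vlim : v n @[n --> \oo] --> c.
  rewrite [X in _ --> X](_ : _ = Num.sqrt (b * b + a ^+ 2)); last first.
    by rewrite -expr2 addrC ab sqrtr_sqr gtr0_norm.
  apply: (@continuous_cvg nat R R \oo _
    (fun n => (b + harmonic n) ^+ 2 + a ^+ 2) Num.sqrt); first exact: sqrt_continuous.
  apply: cvgD; last exact: cvg_cst.
  have l : b + harmonic n @[n --> \oo] --> b.
    rewrite -[X in _ --> X]addr0; apply: cvgD; first exact: cvg_cst.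
    exact: cvg_harmonic.
  by under eq_fun do rewrite expr2; exact: cvgM.
have [|||lR lI] := @cvg_invc R nat \oo _ (fun n => zb + 0 +i* harmonic n + s%:C * (0 +i* v n))
    (zb + s%:C * (0 +i* c)).
- exact: upper_sum_neq0.
- under eq_fun do rewrite !ReD ReZ/= mulr0 !addr0.
  by rewrite ReD ReZ/= mulr0 addr0; exact: cvg_cst.
- under eq_fun do rewrite !ImD ImZ/=.
  rewrite ImD ImZ/= -[X in X + _]addr0; apply: cvgD.
    by apply: cvgD; [exact: cvg_cst|exact: cvg_harmonic].
  by apply: cvgM; [exact: cvg_cst|].
have [dR dI] := @density_transform_cvg (nevanlinna_density r c) zb b0 integrable_nevanlinna_density.
have dR' : complex.Re (density_transform (nevanlinna_density r c) (zb + 0 +i* harmonic n))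
    @[n --> \oo] --> complex.Re ((a ^+ 2)%:C / (zb + s%:C * (0 +i* c))).
  under eq_fun do rewrite E ReZ; rewrite ReZ.
  by apply: cvgM; [exact: cvg_cst|].
have dI' : complex.Im (density_transform (nevanlinna_density r c) (zb + 0 +i* harmonic n))
    @[n --> \oo] --> complex.Im ((a ^+ 2)%:C / (zb + s%:C * (0 +i* c))).
  under eq_fun do rewrite E ImZ; rewrite ImZ.
  by apply: cvgM; [exact: cvg_cst|].
by apply: complex_eqP; [exact: cvg_unique dR dR'|exact: cvg_unique dI dI'].
Qed.

(** The transform G satisfies (z^2 + b^2) G = c^2 (z - s w), while
c^2 (z - s w) (z + s w) = a^2 (z^2 + b^2). The factor z^2 + b^2 cancels except at
z = i b, which is reached as a limit along the imaginary axis. *)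
Lemma nevanlinna_density_transform (z w : R[i]) :
  0 < complex.Im z -> 0 < complex.Im w -> w ^+ 2 = z ^+ 2 - a%:C ^+ 2 ->
  density_transform (nevanlinna_density r c) z = (a ^+ 2)%:C / (z + s%:C * w).
Proof.
move=> z0 w0 w2.
have [zb0|] := eqVneq (z ^+ 2 + b%:C ^+ 2) 0; last exact: nevanlinna_density_transform_generic.
have sq (u : R[i]) (d : R) : 0 < d -> 0 < complex.Im u ->
    u ^+ 2 + d%:C ^+ 2 = 0 -> u = 0 +i* d.
  move=> d0; case: u => x y /= y0; rewrite !expr2 => -[uR uI].
  have xy : x * y = 0 by lra.
  have x0 : x = 0 by apply: (mulIf (lt0r_neq0 y0)); rewrite xy mul0r.
  by rewrite x0 in uR *; congr (_ +i* _); nra.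
have zE : z = zb by apply: sq.
have wE : w = 0 +i* c.
  apply: sq => //; rewrite w2.
  have -> : c%:C ^+ 2 = a%:C ^+ 2 + b%:C ^+ 2 :> R[i].
    by rewrite -!rmorphXn/= -rmorphD/= ab.
  by rewrite addrA subrK.
by rewrite zE wE nevanlinna_density_transform_zb.
Qed.

End nevanlinna_density.
End konno_transform.

(** * Self-decomposability *)

Section self_decomposability.
Context {R : realType}.
Local Notation RT := (measurableTypeR R).
Local Notation leb := (@lebesgue_measure R).
Local Open Scope complex_scope.

Lemma Rintegral_dilation (c : R) (P : probability RT R) (f : R -> R) (B : R) :
  measurable_fun (setT : set RT) f -> (forall x, `|f x| <= B) ->
  \int[dilation c P]_x f x = \int[P]_x f (c * x).
Proof.
move=> mf fB; congr fine; rewrite /dilation integral_distribution//.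
  exact/measurable_EFinP.
apply: (@integrable_bounded _ P (f \o scale_fun c) B); last by move=> x /=.
exact: (measurableT_comp mf (measurable_scale_fun c)).
Qed.

Lemma cauchy_transform_dilation (c : R) (P : probability RT R) (z : R[i]) :
  0 < c -> 0 < complex.Im z ->
  cauchy_transform (dilation c P) z = (c^-1)%:C * cauchy_transform P (z / c%:C).
Proof.
move=> c0 z0; have C0 := real_complex_neq0 (lt0r_neq0 c0).
have kE x : (z - (c * x)%:C)^-1 = (c^-1)%:C * (z / c%:C - x%:C)^-1.
  by rewrite fmorphV rmorphM/= -invfM mulrBr mulrCA divff// mulr1.
have zc0 : 0 < complex.Im (z / c%:C).
  by rewrite mulrC -fmorphV ImZ mulr_gt0// invr_gt0.
apply: complex_eqP.
  rewrite ReZ /=.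
  rewrite (Rintegral_dilation _ _ (lipschitz_measurable (cauchy_kernel_Re_lipschitz z0))
    (cauchy_kernel_Re_bound z0)) -RintegralZl//.
    by apply: eq_Rintegral => x _; rewrite kE ReZ.
  exact: (integrable_bounded P
    (lipschitz_measurable (cauchy_kernel_Re_lipschitz zc0)) (cauchy_kernel_Re_bound zc0)).
rewrite ImZ /=.
rewrite (Rintegral_dilation _ _ (lipschitz_measurable (cauchy_kernel_Im_lipschitz z0))
  (cauchy_kernel_Im_bound z0)) -RintegralZl//.
  by apply: eq_Rintegral => x _; rewrite kE ImZ.
exact: (integrable_bounded P
  (lipschitz_measurable (cauchy_kernel_Im_lipschitz zc0)) (cauchy_kernel_Im_bound zc0)).
Qed.

(** Since (s - z w) (w + s z) = (1 - z^2) (z + s w), the product of G and of the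
right-hand side is 1. *)
Lemma F_transform_konno_field (C : fieldType) (z w s r G : C) :
  s ^+ 2 = 1 - r ^+ 2 -> w ^+ 2 = z ^+ 2 - r ^+ 2 -> w != 0 -> z + s * w != 0 ->
  1 - z ^+ 2 != 0 -> (1 - z ^+ 2) * G = s / w - z -> G^-1 = z - r ^+ 2 / (z + s * w).
Proof.
move=> s2 w2 w0 zw z1 GE.
have F1 : (z - r ^+ 2 / (z + s * w)) * G = 1.
  apply: (mulfI z1); rewrite mulrCA GE mulr1.
  have -> : r ^+ 2 = z ^+ 2 - w ^+ 2 by rewrite w2; ring.
  have -> : (z - (z ^+ 2 - w ^+ 2) / (z + s * w)) * (s / w - z) =
     (z * (s ^+ 2 - w ^+ 2) + s * w * (1 - z ^+ 2)) / (z + s * w).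
    by field; rewrite w0 zw.
  have -> : s ^+ 2 - w ^+ 2 = 1 - z ^+ 2 by rewrite s2 w2; ring.
  by field.
have G0 : G != 0 by apply: contra_eq_neq F1 => ->; rewrite mulr0 eq_sym oner_eq0.
by apply: (mulIf G0); rewrite mulVf.
Qed.

Lemma F_transform_konno (r : R) (r01 : 0 < r < 1) (z : R[i]) : 0 < complex.Im z ->
  F_transform (konno r01) z = z - density_transform (nevanlinna_density r 1) z.
Proof.
move=> z0; have /andP[r0 r1] := r01.
have [w [w2 w0]] := exists_upper_sqrt r0 z0.
have one : 0 < (1 : R) <= 1 by rewrite ltr01 lexx.
rewrite (@nevanlinna_density_transform _ r 1 r01 one z w)// ?mul1r// rmorphXn/=.
rewrite /F_transform (@cauchy_transform_density _ _ (konno_pdf r))//; last 2 first.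
- by move=> x; exact: konno_pdf_ge0.
- exact: integrable_konno_pdf.
apply: F_transform_konno_field w2 _ _ _ (konno_transform r01 z0 w0 w2).
- by rewrite -!rmorphXn/= sqr_sqrtr ?rmorphB ?rmorph1//; nra.
- exact: upper_neq0.
- apply: upper_neq0; rewrite ImD ImZ addr_gt0// mulr_gt0// sqrtr_gt0; nra.
- apply/eqP => z1; have : (z - 1) * (z + 1) == 0.
    by rewrite -subr_sqr expr1n -oppr_eq0 opprB z1.
  rewrite mulf_eq0 subr_eq0 addr_eq0 => /orP[]/eqP zE; move: z0; rewrite zE/=.
    by rewrite ltxx.
  by rewrite oppr0 ltxx.
Qed.

(** F at z for the dilated law is c F(z / c), and c sqrt ((z / c)^2 - r^2) is the
square root of z^2 - (c r)^2 in the upper half-plane. *)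
Lemma F_transform_dilation_konno (r c : R) (r01 : 0 < r < 1) (z : R[i]) :
  0 < c <= 1 -> 0 < complex.Im z ->
  F_transform (dilation c (konno r01)) z = z - density_transform (nevanlinna_density r c) z.
Proof.
move=> c01 z0; have /andP[r0 r1] := r01; have /andP[c0 c1] := c01.
have C0 := real_complex_neq0 (lt0r_neq0 c0).
have zc0 : 0 < complex.Im (z / c%:C).
  by rewrite mulrC -fmorphV ImZ mulr_gt0// invr_gt0.
have [w [w2 w0]] := exists_upper_sqrt r0 zc0.
have one : 0 < (1 : R) <= 1 by rewrite ltr01 lexx.
have -> : F_transform (dilation c (konno r01)) z = c%:C * F_transform (konno r01) (z / c%:C).
  by rewrite /F_transform cauchy_transform_dilation// invfM fmorphV invrK.
rewrite F_transform_konno// (@nevanlinna_density_transform _ r 1 r01 one _ w)// ?mul1r//.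
have cw0 : 0 < complex.Im (c%:C * w) by rewrite ImZ mulr_gt0.
rewrite (@nevanlinna_density_transform _ r c r01 c01 z (c%:C * w))//; last first.
  rewrite exprMn w2 rmorphM/=; move: (c%:C) (r%:C) C0 => C r' C0.
  by field.
set s := (Num.sqrt _)%:C.
have D0 : z / c%:C + s * w != 0.
  apply: upper_neq0; rewrite ImD ImZ addr_gt0// mulr_gt0// sqrtr_gt0; nra.
have D1 : z + s * (c%:C * w) != 0.
  apply: upper_neq0; rewrite ImD ImZ addr_gt0// mulr_gt0// sqrtr_gt0; nra.
have zE : z / c%:C + s * w = (z + s * (c%:C * w)) / c%:C.
  by move: (c%:C) C0 => C C0; field.
rewrite zE !rmorphXn/= rmorphM/=.
move: (c%:C) (r%:C) C0 D1 => C r' C0 D1.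
by field; rewrite C0 D1.
Qed.

(** Both sqrt (c^2 r^2 - x^2) and c^2 / (x^2 + c^2 s^2) are nondecreasing in c. This
inequality is what makes K_r self-decomposable. *)
Lemma nevanlinna_density_le (r c x : R) : 0 < r < 1 -> 0 < c <= 1 -> nevanlinna_density r c x <= nevanlinna_density r 1 x.
Proof.
move=> /andP[r0 r1] /andP[c0 c1]; rewrite /nevanlinna_density !mul1r.
have s0 : 0 < Num.sqrt (1 - r ^+ 2) by rewrite sqrtr_gt0; nra.
move: (Num.sqrt (1 - r ^+ 2)) s0 => s s0.
have c2 : c ^+ 2 <= 1 by rewrite exprn_ile1// ltW.
have q : Num.sqrt ((c * r) ^+ 2 - x ^+ 2) <= Num.sqrt (r ^+ 2 - x ^+ 2).
  apply: ler_wsqrtr; by rewrite lerD2r exprMn ler_piMl ?sqr_ge0.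
have D1 : 0 < x ^+ 2 + s ^+ 2 by rewrite ltr_wpDl ?sqr_ge0// exprn_gt0.
have Dc : 0 < x ^+ 2 + (c * s) ^+ 2.
  by rewrite ltr_wpDl ?sqr_ge0// exprn_gt0// mulr_gt0.
have k : c ^+ 2 / (x ^+ 2 + (c * s) ^+ 2) <= (x ^+ 2 + s ^+ 2)^-1.
  rewrite ler_pdivrMr// mulrC ler_pdivlMr// mulrDr exprMn lerD2r.
  by rewrite ler_piMl ?sqr_ge0.
have sp : 0 <= s / pi by rewrite divr_ge0 ?pi_ge0 ?ltW.
have -> : s * c ^+ 2 / pi * Num.sqrt ((c * r) ^+ 2 - x ^+ 2) / (x ^+ 2 + (c * s) ^+ 2) =
  s / pi * (Num.sqrt ((c * r) ^+ 2 - x ^+ 2) * (c ^+ 2 / (x ^+ 2 + (c * s) ^+ 2))) by ring.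
have -> : s * 1 ^+ 2 / pi * Num.sqrt (r ^+ 2 - x ^+ 2) / (x ^+ 2 + s ^+ 2) =
  s / pi * (Num.sqrt (r ^+ 2 - x ^+ 2) * (x ^+ 2 + s ^+ 2)^-1) by ring.
apply: ler_wpM2l => //; apply: ler_pM => //.
by rewrite divr_ge0 ?sqr_ge0 ?ltW.
Qed.

End self_decomposability.


Theorem theorem6p8 (R : realType) (r : R) (r01 : 0 < r < 1) :
  boolean_self_decomposable (konno r01).
Proof.
move=> c /andP[c0 c1].
have c01 : 0 < c <= 1 by rewrite c0 ltW.
have one : 0 < (1 : R) <= 1 by rewrite ltr01 lexx.
pose sigma x := nevanlinna_density r 1 x - nevanlinna_density r c x.
have i1 := integrable_nevanlinna_density r01 one; have ic := integrable_nevanlinna_density r01 c01.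
have isigma : (@lebesgue_measure R).-integrable setT (EFin \o sigma).
  by have := integrableB measurableT i1 ic; apply: eq_integrable.
have sigma_ge0 x : 0 <= sigma x by rewrite subr_ge0 nevanlinna_density_le.
have sigma_supp (x : R) : x \notin `]- 1, 1] -> sigma x = 0.
  by move=> x1; rewrite /sigma !nevanlinna_density_eq0// subrr.
have [nu nuE] := nevanlinna_compact_support sigma_ge0 isigma sigma_supp.
exists nu => z z0.
rewrite F_transform_konno// F_transform_dilation_konno// nuE//.
have -> : density_transform sigma z =
    density_transform (nevanlinna_density r 1) z - density_transform (nevanlinna_density r c) z.
  rewrite !density_transformE -[X in _ - X]mul1r -mulNr -cintZ; last exact: cintegrable_kernel.
  rewrite -cintD; [|exact: cintegrable_kernel|by apply: cintegrableZ; exact: cintegrable_kernel].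
  by apply: eq_cint => x; rewrite rmorphB/= mulrBl mulN1r.
by ring.
Qed.
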